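(* Let $k$ be an algebraically closed field and let $A=kQ/I$ be a basic finite-dimensional $k$-algebra, where $Q$ is a finite quiver, $I$ is an admissible ideal of $kQ$, and $e_i$ denotes the idempotent of $A$ given by the path of length zero at the vertex $i\in Q_0$. For $l\in Q_0$ let $N(l)$ be the set of vertices $j\neq l$ that are connected to $l$ by at least one arrow of $Q$ (in either direction). Then $A$ is biserial if and only if for every vertex $l\in Q_0$ and every subset $J\subseteq N(l)$ with $|J|\le 3$, the algebra $eAe$ with $e=e_l+\sum_{j\in J}e_j$ is biserial.
   Context: A finite-dimensional algebra $B$ is called biserial if for every indecomposable projective left or right $B$-module $P$ there exist uniserial submodules $U,V$ of $P$ with $\operatorname{rad}(P)=U+V$ (the sum not necessarily direct) such that $U\cap V$ is zero or simple. The algebra $eAe$ has unit $e$. *)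

(* Defs.v *)
From HB Require Import structures.
From mathcomp Require Import all_boot all_algebra finmap.
From mathcomp Require Import boolp classical_sets.
From mathcomp Require Import monalg.

Set Implicit Arguments.
Unset Strict Implicit.
Unset Printing Implicit Defensive.

Import GRing.Theory.
Local Open Scope classical_set_scope.
Local Open Scope ring_scope.

(* All rings are [pzRingType]s rather than [algType]s: the library's [algType]
   requires [1 != 0], which would exclude the quiver without vertices, and
   biserial is a property of the underlying ring. *)

Section Submodules.
Variables (R : pzRingType) (M : lmodType R).
Implicit Types U V W : set M.

Definition submodule U : Prop :=
  U 0 /\ forall (a : R) (u v : M), U u -> U v -> U (a *: u + v).

Definition addsm U V : set M := [set w | exists2 u, U u & exists2 v, V v & w = u + v].

Definition simple_submodule U : Prop :=
  [/\ submodule U, U <> [set 0] &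
      forall V, submodule V -> V `<=` U -> V = [set 0] \/ V = U].

(* The zero submodule is uniserial. *)
Definition uniserial_submodule U : Prop :=
  submodule U /\
  forall V W, submodule V -> submodule W -> V `<=` U -> W `<=` U ->
    V `<=` W \/ W `<=` V.

Definition maximal_submodule U : Prop :=
  [/\ submodule U, U <> setT &
      forall V, submodule V -> U `<=` V -> V = U \/ V = setT].

Definition radical : set M := \bigcap_(U in maximal_submodule) U.

Definition indecomposable : Prop :=
  [set: M] <> [set 0] /\
  forall U V, submodule U -> submodule V ->
    addsm U V = setT -> U `&` V = [set 0] -> U = [set 0] \/ V = [set 0].

Definition projective : Prop :=
  forall (X Y : lmodType R) (g : {linear X -> Y}) (f : {linear M -> Y}),
    (forall y, exists x, g x = y) ->
    exists h : {linear M -> X}, forall m, g (h m) = f m.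

Definition biserial_module : Prop :=
  exists U V : set M,
    [/\ uniserial_submodule U, uniserial_submodule V, radical = addsm U V &
        U `&` V = [set 0] \/ simple_submodule (U `&` V)].

End Submodules.

(* Right B-modules are left modules over the converse ring [B^c]. *)
Definition biserial (B : pzRingType) : Prop :=
  (forall P : lmodType B, indecomposable P -> projective P -> biserial_module P) /\
  (forall P : lmodType B^c, indecomposable P -> projective P -> biserial_module P).

Section Ideals.
Variable R : pzRingType.

Record two_sided_ideal := TwoSidedIdeal {
  ideal_set :> set R;
  ideal0 : ideal_set 0;
  idealD : forall x y, ideal_set x -> ideal_set y -> ideal_set (x + y);
  idealMl : forall a x, ideal_set x -> ideal_set (a * x);
  idealMr : forall a x, ideal_set x -> ideal_set (x * a)
}.

Definition generated_ideal (S : set R) : set R :=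
  [set x | forall I : two_sided_ideal, S `<=` I -> ideal_set I x].

Definition mul_ideal (I J : set R) : set R :=
  generated_ideal [set z | exists2 x, I x & exists2 y, J y & z = x * y].

Fixpoint exp_ideal (I : set R) (n : nat) : set R :=
  if n is n'.+1 then mul_ideal I (exp_ideal I n') else setT.

Variable I : two_sided_ideal.

Definition ideal_pred : {pred R} := fun x => `[< ideal_set I x >].

Lemma ideal_predP x : reflect (ideal_set I x) (x \in ideal_pred).
Proof. exact: asboolP. Qed.

Lemma ideal_pred_zmod_closed : zmod_closed ideal_pred.
Proof.
split=> [|x y /ideal_predP Ix /ideal_predP Iy]; apply/ideal_predP.
  exact: ideal0.
by apply: idealD => //; rewrite -mulN1r; apply: idealMl.
Qed.

HB.instance Definition _ :=
  GRing.isZmodClosed.Build R ideal_pred ideal_pred_zmod_closed.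

Definition quotient : Type := Quotient.quot ideal_pred.

HB.instance Definition _ := GRing.Zmodule.on quotient.

Definition to_quotient (x : R) : quotient := (\pi_(Quotient.quot ideal_pred) x)%qT.
Definition quotient_lift (x : quotient) : R := repr x.

Lemma quotient_liftK : cancel quotient_lift to_quotient.
Proof. exact: reprK. Qed.

Lemma eq_to_quotient x y : to_quotient x = to_quotient y <-> ideal_set I (x - y).
Proof.
split=> [/eqP|Ixy]; last apply/eqP.
  by rewrite /to_quotient -Quotient.idealrBE => /ideal_predP.
by rewrite /to_quotient -Quotient.idealrBE; apply/ideal_predP.
Qed.

Lemma to_quotientD : {morph to_quotient : x y / x + y}.
Proof. by move=> x y; rewrite /to_quotient Quotient.pi_add. Qed.

Definition quotient_one : quotient := to_quotient 1.
Definition quotient_mul (x y : quotient) : quotient :=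
  to_quotient (quotient_lift x * quotient_lift y).

Lemma to_quotientM x y :
  to_quotient (x * y) = quotient_mul (to_quotient x) (to_quotient y).
Proof.
rewrite /quotient_mul; set x' := quotient_lift _; set y' := quotient_lift _.
have Ix : ideal_set I (x - x') by apply/eq_to_quotient; rewrite quotient_liftK.
have Iy : ideal_set I (y - y') by apply/eq_to_quotient; rewrite quotient_liftK.
apply/eq_to_quotient.
have -> : x * y - x' * y' = (x - x') * y + x' * (y - y').
  by rewrite mulrBl mulrBr addrA subrK.
by apply: idealD; [apply: idealMr | apply: idealMl].
Qed.

Lemma quotient_mulA : associative quotient_mul.
Proof.
move=> x y z; rewrite -[x]quotient_liftK -[y]quotient_liftK -[z]quotient_liftK.
by rewrite -!to_quotientM mulrA.
Qed.
Lemma quotient_mul1 : left_id quotient_one quotient_mul.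
Proof. by move=> x; rewrite -[x]quotient_liftK -to_quotientM mul1r. Qed.
Lemma quotient_1mul : right_id quotient_one quotient_mul.
Proof. by move=> x; rewrite -[x]quotient_liftK -to_quotientM mulr1. Qed.
Lemma quotient_mulDl : left_distributive quotient_mul +%R.
Proof.
move=> x y z; rewrite -[x]quotient_liftK -[y]quotient_liftK -[z]quotient_liftK.
by rewrite -to_quotientD -!to_quotientM mulrDl to_quotientD.
Qed.
Lemma quotient_mulDr : right_distributive quotient_mul +%R.
Proof.
move=> x y z; rewrite -[x]quotient_liftK -[y]quotient_liftK -[z]quotient_liftK.
by rewrite -to_quotientD -!to_quotientM mulrDr to_quotientD.
Qed.

HB.instance Definition _ := GRing.Zmodule_isPzRing.Build quotient
  quotient_mulA quotient_mul1 quotient_1mul quotient_mulDl quotient_mulDr.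

Lemma to_quotient_is_zmod_morphism : zmod_morphism to_quotient.
Proof.
move=> x y; apply: (addIr (to_quotient y)).
by rewrite subrK -to_quotientD subrK.
Qed.
Lemma to_quotient_is_monoid_morphism : monoid_morphism to_quotient.
Proof. by split=> // x y; apply: to_quotientM. Qed.

HB.instance Definition _ := GRing.isZmodMorphism.Build R quotient to_quotient
  to_quotient_is_zmod_morphism.
HB.instance Definition _ := GRing.isMonoidMorphism.Build R quotient to_quotient
  to_quotient_is_monoid_morphism.

End Ideals.

Section Corner.
Variables (R : pzRingType) (e : R).

Definition corner_pred : {pred R} := fun x => `[< exists a, x = e * a * e >].

Lemma corner_predP x : reflect (exists a, x = e * a * e) (x \in corner_pred).
Proof. exact: asboolP. Qed.

Lemma corner_pred_zmod_closed : zmod_closed corner_pred.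
Proof.
split=> [|x y /corner_predP[a ->] /corner_predP[b ->]]; apply/corner_predP.
  by exists 0; rewrite mulr0 mul0r.
by exists (a - b); rewrite mulrBr mulrBl.
Qed.

HB.instance Definition _ :=
  GRing.isZmodClosed.Build R corner_pred corner_pred_zmod_closed.

(* The ring eRe with unit e; the proof [ee] is a parameter of the type because
   e is a unit only when it is idempotent. *)
Record corner (ee : e * e = e) :=
  Corner { corner_val :> R; corner_valP : corner_val \in corner_pred }.

Hypothesis ee : e * e = e.

HB.instance Definition _ := [isSub for @corner_val ee].
HB.instance Definition _ := [Choice of corner ee by <:].
HB.instance Definition _ := [SubChoice_isSubZmodule of corner ee by <:].

Lemma corner_one_subproof : e \in corner_pred.
Proof. by apply/corner_predP; exists e; rewrite !ee. Qed.
Lemma corner_mul_subproof (x y : corner ee) : corner_val x * corner_val y \in corner_pred.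
Proof.
case: x y => x /= /corner_predP[a ->] [y /= /corner_predP[b ->]].
by apply/corner_predP; exists (a * e * (e * b)); rewrite !mulrA.
Qed.

Definition corner_one : corner ee := Corner ee corner_one_subproof.
Definition corner_mul (x y : corner ee) : corner ee := Corner ee (corner_mul_subproof x y).

Lemma corner_mulA : associative corner_mul.
Proof. by move=> x y z; apply/val_inj; rewrite /= mulrA. Qed.
Lemma corner_mul1 : left_id corner_one corner_mul.
Proof.
move=> [x xP]; apply/val_inj => /=.
by case/corner_predP: xP => a ->; rewrite !mulrA ee.
Qed.
Lemma corner_1mul : right_id corner_one corner_mul.
Proof.
move=> [x xP]; apply/val_inj => /=.
by case/corner_predP: xP => a ->; rewrite -!mulrA ee.
Qed.
Lemma corner_mulDl : left_distributive corner_mul +%R.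
Proof. by move=> x y z; apply/val_inj; rewrite /= mulrDl. Qed.
Lemma corner_mulDr : right_distributive corner_mul +%R.
Proof. by move=> x y z; apply/val_inj; rewrite /= mulrDr. Qed.

HB.instance Definition _ := GRing.Zmodule_isPzRing.Build (corner ee)
  corner_mulA corner_mul1 corner_1mul corner_mulDl corner_mulDr.

End Corner.

Arguments corner {R} e ee.

Record quiver := Quiver {
  vertex : finType;
  arrow : finType;
  source : arrow -> vertex;
  target : arrow -> vertex
}.

Section PathAlgebra.
Variables (k : fieldType) (Q : quiver).

Fixpoint walk (i : vertex Q) (s : seq (arrow Q)) : bool :=
  if s is a :: s' then (source a == i) && walk (target a) s' else true.

(* A path is its starting vertex together with its arrows, in the order in
   which they are traversed. *)
Record qpath := QPath {
  qpath_val : vertex Q * seq (arrow Q);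
  qpath_valP : walk qpath_val.1 qpath_val.2
}.

HB.instance Definition _ := [isSub for qpath_val].
HB.instance Definition _ := [Choice of qpath by <:].

Definition qpath_source (p : qpath) : vertex Q := (qpath_val p).1.
Definition qpath_arrows (p : qpath) : seq (arrow Q) := (qpath_val p).2.
Definition qpath_target (p : qpath) : vertex Q :=
  last (qpath_source p) [seq target a | a <- qpath_arrows p].

Lemma walk_cat i s t :
  walk i (s ++ t) = walk i s && walk (last i [seq target a | a <- s]) t.
Proof. by elim: s i => //= a s IHs i; rewrite IHs andbA. Qed.

Definition trivial_path (i : vertex Q) : qpath := @QPath (i, [::]) isT.

Lemma arrow_path_subproof (a : arrow Q) : walk (source a) [:: a].
Proof. by rewrite /= eqxx. Qed.
Definition arrow_path (a : arrow Q) : qpath :=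
  @QPath (source a, [:: a]) (arrow_path_subproof a).

Lemma qpath_cat_subproof (p q : qpath) : qpath_target p = qpath_source q ->
  walk (qpath_source p) (qpath_arrows p ++ qpath_arrows q).
Proof.
by move=> e; rewrite walk_cat [X in walk X (qpath_arrows q)]e !qpath_valP.
Qed.

(* The product p q of two paths is "first p, then q". *)
Definition qpath_cat (p q : qpath) : option qpath :=
  match qpath_target p =P qpath_source q with
  | ReflectT e => Some (@QPath (_, _) (qpath_cat_subproof e))
  | ReflectF _ => None
  end.

Definition path_algebra : Type := {malg k[qpath]}.

HB.instance Definition _ := GRing.Lmodule.on path_algebra.

Definition path_elt (p : qpath) : path_algebra := << p >>.

Definition path_mul (p q : qpath) : path_algebra :=
  if qpath_cat p q is Some r then path_elt r else 0.

Definition pa_one : path_algebra := \sum_(i : vertex Q) path_elt (trivial_path i).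

Definition pa_mul (x y : path_algebra) : path_algebra :=
  \sum_(p <- msupp x) \sum_(q <- msupp y) (x@_p * y@_q) *: path_mul p q.

Section LinearExtension.
Variable V : lmodType k.
Implicit Types (f g : qpath -> V) (x y : path_algebra).

Definition linext f x : V := \sum_(p <- msupp x) x@_p *: f p.

Lemma linextEw f x (d : {fset qpath}) : (msupp x `<=` d)%fset ->
  linext f x = \sum_(p <- d) x@_p *: f p.
Proof.
move=> le_d; rewrite /linext (big_fset_incl _ le_d) // => p _ /mcoeff_outdom ->.
by rewrite scale0r.
Qed.

Lemma linextP f (c : k) x y : linext f (c *: x + y) = c *: linext f x + linext f y.
Proof.
pose d := (msupp x `|` msupp y `|` msupp (c *: x + y))%fset.
rewrite !(@linextEw _ _ d) /d; first last.
- exact: fsubsetUr.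
- by rewrite -fsetUA fsubsetUl.
- by rewrite (fsubset_trans (fsubsetUr (msupp x) _)) ?fsubsetUl.
rewrite scaler_sumr -big_split; apply: eq_bigr => p _ /=.
by rewrite mcoeffD mcoeffZ scalerDl scalerA.
Qed.

Lemma linextD f x y : linext f (x + y) = linext f x + linext f y.
Proof. by have := linextP f 1 x y; rewrite !scale1r. Qed.
Lemma linext0 f : linext f 0 = 0.
Proof. by rewrite /linext msupp0 big_nil. Qed.
Lemma linextZ f c x : linext f (c *: x) = c *: linext f x.
Proof. by have := linextP f c x 0; rewrite linext0 !addr0. Qed.
Lemma linext_sum f (J : Type) (r : seq J) (F : J -> path_algebra) :
  linext f (\sum_(j <- r) F j) = \sum_(j <- r) linext f (F j).
Proof.
by apply: (big_morph (linext f)); [apply: linextD | apply: linext0].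
Qed.

Lemma linext_elt f p : linext f (path_elt p) = f p.
Proof.
by rewrite (@linextEw _ _ [fset p]%fset) ?msuppU_le // big_seq_fset1 mcoeffUU scale1r.
Qed.

Lemma eq_linext f g x : f =1 g -> linext f x = linext g x.
Proof. by move=> fg; apply: eq_bigr => p _; rewrite fg. Qed.

End LinearExtension.

Lemma linext_id (x : path_algebra) : linext path_elt x = x.
Proof.
rewrite [RHS]monalgE; apply: eq_bigr => p _; apply/malgP => q.
by rewrite mcoeffZ !mcoeffU mulrnAr mulr1.
Qed.

Lemma pa_mulE x y : pa_mul x y = linext (fun p => linext (path_mul p) y) x.
Proof.
apply: eq_bigr => p _; rewrite scaler_sumr; apply: eq_bigr => q _.
by rewrite scalerA.
Qed.

Lemma pa_mulEr x y : pa_mul x y = linext (fun q => linext (path_mul^~ q) x) y.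
Proof.
rewrite /pa_mul exchange_big; apply: eq_bigr => q _ /=.
rewrite scaler_sumr; apply: eq_bigr => p _.
by rewrite scalerA mulrC.
Qed.

Lemma pa_mulDl : left_distributive pa_mul +%R.
Proof. by move=> x y z; rewrite !pa_mulE linextD. Qed.
Lemma pa_mulDr : right_distributive pa_mul +%R.
Proof. by move=> x y z; rewrite !pa_mulEr linextD. Qed.
Lemma pa_mulZl c x y : pa_mul (c *: x) y = c *: pa_mul x y.
Proof. by rewrite !pa_mulE linextZ. Qed.
Lemma pa_mulZr c x y : pa_mul x (c *: y) = c *: pa_mul x y.
Proof. by rewrite !pa_mulEr linextZ. Qed.
Lemma pa_mul0l y : pa_mul 0 y = 0.
Proof. by rewrite pa_mulE linext0. Qed.
Lemma pa_mul0r x : pa_mul x 0 = 0.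
Proof. by rewrite pa_mulEr linext0. Qed.
Lemma pa_mulUU p q : pa_mul (path_elt p) (path_elt q) = path_mul p q.
Proof. by rewrite pa_mulE !linext_elt. Qed.

Lemma path_elt_ind (P : path_algebra -> Prop) :
  P 0 -> (forall c x y, P x -> P y -> P (c *: x + y)) ->
  (forall p, P (path_elt p)) -> forall x, P x.
Proof.
move=> P0 PD PU x; rewrite -(linext_id x) /linext.
by elim/big_ind: _ => // [y z Py Pz|p _]; [rewrite -[y]scale1r|rewrite -[X in P X]addr0]; apply: PD.
Qed.

Lemma qpath_catP p q r : qpath_cat p q = Some r <->
  qpath_target p = qpath_source q /\
  qpath_val r = (qpath_source p, qpath_arrows p ++ qpath_arrows q).
Proof.
rewrite /qpath_cat; case: eqP => [e|ne]; last by split=> // -[].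
split=> [[<-] //|[_ er]]; congr Some; exact/val_inj.
Qed.

Lemma qpath_cat_None p q :
  qpath_cat p q = None <-> qpath_target p <> qpath_source q.
Proof. by rewrite /qpath_cat; case: eqP. Qed.

Lemma qpath_cat_target p q r : qpath_cat p q = Some r ->
  qpath_target r = qpath_target q.
Proof.
case/qpath_catP=> e er; rewrite /qpath_target /qpath_source /qpath_arrows er /=.
by rewrite map_cat last_cat; move: e; rewrite /qpath_target => ->.
Qed.

Lemma qpath_cat_source p q r : qpath_cat p q = Some r ->
  qpath_source r = qpath_source p.
Proof. by case/qpath_catP=> _ er; rewrite /qpath_source er. Qed.

Lemma qpath_catA p q r :
  obind (qpath_cat p) (qpath_cat q r) = obind (qpath_cat^~ r) (qpath_cat p q).
Proof.
case Eqr: (qpath_cat q r) => [s|]; case Epq: (qpath_cat p q) => [t|] //=.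
- have [epq et] := (qpath_catP _ _ _).1 Epq.
  have [eqr es] := (qpath_catP _ _ _).1 Eqr.
  case Etr: (qpath_cat t r) => [u|]; last first.
    by case/qpath_cat_None: Etr; rewrite (qpath_cat_target Epq).
  apply/qpath_catP; rewrite (qpath_cat_source Eqr); split=> //.
  case/qpath_catP: Etr => _ ->.
  by rewrite /qpath_source /qpath_arrows et es /= catA.
- by move/qpath_cat_None: Epq => ne; apply/qpath_cat_None; rewrite (qpath_cat_source Eqr).
- move/qpath_cat_None: Eqr => ne; apply/esym/qpath_cat_None.
  by rewrite (qpath_cat_target Epq).
Qed.

Lemma pa_mulA : associative pa_mul.
Proof.
move=> x y z; elim/path_elt_ind: x => [|c x x' IH IH'|p].
- by rewrite !pa_mul0l.
- by rewrite !(pa_mulDl, pa_mulZl) IH IH'.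
elim/path_elt_ind: y => [|c y y' IH IH'|q].
- by rewrite !(pa_mul0l, pa_mul0r).
- by rewrite !(pa_mulDl, pa_mulZl, pa_mulDr, pa_mulZr) IH IH'.
elim/path_elt_ind: z => [|c z z' IH IH'|r].
- by rewrite !pa_mul0r.
- by rewrite !(pa_mulDr, pa_mulZr) IH IH'.
have := qpath_catA p q r; rewrite !pa_mulUU /path_mul.
case: (qpath_cat q r) => [s|]; case: (qpath_cat p q) => [t|] //=;
  rewrite ?pa_mulUU ?pa_mul0l ?pa_mul0r // /path_mul => E.
- by rewrite E.
- by rewrite E.
- by rewrite -E.
Qed.

Lemma path_mul1 i p :
  path_mul (trivial_path i) p = if i == qpath_source p then path_elt p else 0.
Proof.
rewrite /path_mul; case E: (qpath_cat _ _) => [r|].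
  have [ei er] := (qpath_catP _ _ _).1 E.
  rewrite -[i]/(qpath_target (trivial_path i)) ei eqxx.
  congr path_elt; apply/val_inj; rewrite /= er [qpath_source _]ei.
  by rewrite /qpath_source /qpath_arrows /=; case: (qpath_val p).
by have /eqP/negPf := (qpath_cat_None _ _).1 E; rewrite {1}/qpath_target /= => ->.
Qed.

Lemma path_1mul i p :
  path_mul p (trivial_path i) = if i == qpath_target p then path_elt p else 0.
Proof.
rewrite /path_mul eq_sym; case E: (qpath_cat _ _) => [r|].
  have [ei er] := (qpath_catP _ _ _).1 E; rewrite ei eqxx.
  congr path_elt; apply/val_inj; rewrite /= er cats0.
  by rewrite /qpath_source /qpath_arrows; case: (qpath_val p).
by have /eqP/negPf -> := (qpath_cat_None _ _).1 E.
Qed.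

Lemma pa_mul1 : left_id pa_one pa_mul.
Proof.
move=> x; rewrite pa_mulEr -[RHS]linext_id; apply: eq_linext => p.
rewrite /pa_one linext_sum (bigD1 (qpath_source p)) //=.
rewrite linext_elt path_mul1 eqxx big1 ?addr0 // => i /negPf ne.
by rewrite linext_elt path_mul1 ne.
Qed.

Lemma pa_1mul : right_id pa_one pa_mul.
Proof.
move=> x; rewrite pa_mulE -[RHS]linext_id; apply: eq_linext => p.
rewrite /pa_one linext_sum (bigD1 (qpath_target p)) //=.
rewrite linext_elt path_1mul eqxx big1 ?addr0 // => i /negPf ne.
by rewrite linext_elt path_1mul ne.
Qed.

HB.instance Definition _ := GRing.Zmodule_isPzRing.Build path_algebra
  pa_mulA pa_mul1 pa_1mul pa_mulDl pa_mulDr.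

Definition arrow_ideal : set path_algebra :=
  generated_ideal [set x | exists a : arrow Q, x = path_elt (arrow_path a)].

(* Ideals of kQ are automatically k-subspaces since c *: x = (c *: 1) * x.
   For admissible I the algebra kQ/I is automatically basic and
   finite-dimensional. *)
Definition admissible (I : two_sided_ideal path_algebra) : Prop :=
  exists2 m : nat, (2 <= m)%N &
    exp_ideal arrow_ideal m `<=` I /\ I `<=` exp_ideal arrow_ideal 2.

Variable I : two_sided_ideal path_algebra.

Definition vertex_idem (i : vertex Q) : quotient I :=
  to_quotient I (path_elt (trivial_path i)).

Definition neighbours (l : vertex Q) : {set vertex Q} :=
  [set j | (j != l) && [exists a : arrow Q,
     ((source a == l) && (target a == j)) || ((source a == j) && (target a == l))]]%SET.

Definition star_idem (l : vertex Q) (J : {set vertex Q}) : quotient I :=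
  vertex_idem l + \sum_(j in J) vertex_idem j.

Lemma vertex_idemM i j :
  vertex_idem i * vertex_idem j = if i == j then vertex_idem i else 0.
Proof.
rewrite /vertex_idem -rmorphM [_ * _]pa_mulUU path_mul1 /qpath_source /=.
by case: eqP => [->|_] //; rewrite rmorph0.
Qed.

Lemma star_idemP (l : vertex Q) (J : {set vertex Q}) :
  J \subset neighbours l -> star_idem l J * star_idem l J = star_idem l J.
Proof.
move=> /fintype.subsetP JN; have lJ : l \notin J.
  by apply/negP => /JN; rewrite inE eqxx.
rewrite /star_idem -(big_setU1 _ lJ) /= mulr_suml; apply: eq_bigr => i iS.
rewrite mulr_sumr (bigD1 i) //= vertex_idemM eqxx big1 ?addr0 // => j /andP[_ ne].
by rewrite vertex_idemM eq_sym (negPf ne).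
Qed.

End PathAlgebra.

(* Main.v *)
(* Write [J] for the radical, generated by the arrows. [A] is biserial iff for
   every vertex [l], on both sides, [J e_l = A x + A x'] with [A x] and [A x']
   uniserial and [A x :&: A x'] killed by [J].  This passes to [e A e] for any
   sum [e] of vertices, by applying [e] to the uniserial submodules.

   Conversely, call [x] good if [J x] is cyclic.  The star around [l] shows that
   at most two arrows end at [l]; the star around the source [j] of such an arrow,
   with [l] and the sources of the at most two arrows ending at [j], shows that
   [J e_l] is generated by two good elements (possibly zero).  Iterating, good generators
   are uniserial, and dually on the right.

   Only the intersection [W] of [A x] and [A x'] remains.  If [J W <> 0], let
   [W = J^d x = J^d' x'] be generated by [t = p x = q x'], with [d <= d'], and pick
   [w] with [w A] uniserial and [w t] outside [J^2 W].  Comparing [w p] and [w q] in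
   [w A] gives [r] with [w q = w p r], and [z = r x'] agrees with [x] to high order:
   [p z = (1 + j) t] with [j] in [J].  If [d = 1] the pair [(x - z, x')] is
   again uniserial and strictly shorter.  If [d > 1], factor [p = p' h] with [h A]
   uniserial; then [h J = h x A], so [h z = h x a].  If [a] is in [J], then
   [t a = (1 + j) t] contradicts nilpotency; otherwise [a] is invertible, and
   [(x, z - x a)] is a uniserial pair which is strictly shorter. *)

From HB Require Import structures.
From mathcomp Require Import all_boot all_algebra.
From mathcomp Require Import finmap boolp classical_sets monalg ring.
Require Import Defs.

Set Implicit Arguments.
Unset Strict Implicit.
Unset Printing Implicit Defensive.

Import GRing.Theory.
Local Open Scope ring_scope.

(** * Powers of the radical and the element form of biseriality *)

(** No ideal structure on [J] is presupposed, so the same definition serves in an algebra, its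
    corners and their opposites. *)
Inductive ideal_power (R : pzRingType) (J : R -> Prop) : nat -> R -> Prop :=
| ideal_power_all a : ideal_power J 0 a
| ideal_power_zero n : ideal_power J n 0
| ideal_power_add n a b :
    ideal_power J n a -> ideal_power J n b -> ideal_power J n (a + b)
| ideal_power_mul n a b : J a -> ideal_power J n b -> ideal_power J n.+1 (a * b).

(* Some [e i] may be zero, so that an algebra and its corners [f R f] can share
   the index set [V]. *)
Record split_basic (k : fieldType) (V : finType) (R : pzRingType)
    (s : k -> R) (e : V -> R) (J : R -> Prop) : Prop := SplitBasic {
  scal1 : s 1 = 1;
  scalB : forall c d, s (c - d) = s c - s d;
  scalM : forall c d, s (c * d) = s c * s d;
  scalC : forall c a, s c * a = a * s c;
  idem_mul : forall i j, e i * e j = if i == j then e i else 0;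
  idem_sum : \sum_i e i = 1;
  rad0 : J 0;
  radD : forall a b, J a -> J b -> J (a + b);
  radMl : forall a b, J b -> J (a * b);
  radMr : forall a b, J a -> J (a * b);
  rad_nil : exists n, forall a, ideal_power J n a -> a = 0;
  idem_local : forall a i, exists c, J (a * e i - s c * e i)
}.

(** A module is uniserial as soon as its cyclic submodules form a chain, so comparing [R a x] with
    [R b x] suffices. *)
Definition left_uniserial (R : pzRingType) (x : R) : Prop :=
  forall a b, exists c, a * x = c * (b * x) \/ b * x = c * (a * x).

Definition right_uniserial (R : pzRingType) (w : R) : Prop :=
  forall a b, exists c, w * a = w * b * c \/ w * b = w * a * c.

(** Zero and elements of [J^2] are allowed, so a vertex with fewer than two arrows is no special
    case. *)
Definition radical_arrow (R : pzRingType) (V : Type) (e : V -> R)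
    (J : R -> Prop) (i l : V) (x : R) : Prop :=
  [/\ J x, e i * x = x & x * e l = x].

Definition radical_span (R : pzRingType) (V : Type) (e : V -> R)
    (J : R -> Prop) (l : V) (x x' : R) : Prop :=
  forall y, J y -> exists a b, y * e l = a * x + b * x'.

(** The last clause makes the intersection of [R x] and [R x'] semisimple; inside a uniserial module
    this means zero or simple. *)
Definition left_biserial_at (R : pzRingType) (V : Type) (e : V -> R)
    (J : R -> Prop) (l : V) : Prop :=
  exists i x i' x',
  [/\ radical_arrow e J i l x /\ radical_arrow e J i' l x',
      radical_span e J l x x', left_uniserial x, left_uniserial x' &
      forall a b u, a * x = b * x' -> J u -> u * (a * x) = 0].

(** * Calculus in a split basic algebra *)

Section SplitBasic.
Variables (k : fieldType) (V : finType) (R : pzRingType).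
Variables (s : k -> R) (e : V -> R) (J : R -> Prop).
Hypothesis S : split_basic s e J.

Notation Jp := (ideal_power J).
Notation arr := (radical_arrow e J).

Lemma scal0 : s 0 = 0. Proof. by have := scalB S 0 0; rewrite !subrr. Qed.
Lemma scalN c : s (- c) = - s c.
Proof. by have := scalB S 0 c; rewrite !sub0r scal0 sub0r. Qed.
Lemma scalD c d : s (c + d) = s c + s d.
Proof. by rewrite -[d]opprK (scalB S) !scalN !opprK. Qed.

Lemma idem_id i : e i * e i = e i. Proof. by rewrite (idem_mul S) eqxx. Qed.
Lemma idem_neq i j : i != j -> e i * e j = 0.
Proof. by rewrite (idem_mul S) => /negPf ->. Qed.

Lemma radN a : J a -> J (- a).
Proof. by move=> Ja; rewrite -mulN1r; apply: (radMl S). Qed.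
Lemma radB a b : J a -> J b -> J (a - b).
Proof. by move=> Ja Jb; apply: (radD S) => //; apply: radN. Qed.

Lemma rad_sum (I : Type) (r : seq I) (P : pred I) (F : I -> R) :
  (forall i, P i -> J (F i)) -> J (\sum_(i <- r | P i) F i).
Proof. by apply: big_ind; [apply: (rad0 S) | apply: (radD S)]. Qed.

Lemma pow_ind n (P : R -> Prop) : P 0 -> (forall a b, P a -> P b -> P (a + b)) ->
  (forall a b, J a -> Jp n b -> P (a * b)) -> forall a, Jp n.+1 a -> P a.
Proof.
move=> P0 PD PM a; move E: n.+1 => m Ja.
elim: Ja E => // [m' a' b' _ IHa _ IHb /[dup] /IHa Pa /IHb|m' a' b' Ja Jb _ [E]].
  exact: PD.
by apply: PM => //; rewrite E.
Qed.

Lemma powMl n a b : Jp n b -> Jp n (a * b).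
Proof.
move=> H; elim: H a => [*|m a|m a' b' _ IHa _ IHb a|m a' b' Ja Jb _ a].
- exact: ideal_power_all.
- by rewrite mulr0; apply: ideal_power_zero.
- by rewrite mulrDr; apply: ideal_power_add.
- by rewrite mulrA; apply: ideal_power_mul => //; apply: (radMl S).
Qed.

Lemma pow1 a : J a -> Jp 1 a.
Proof. by move=> Ja; rewrite -[a]mulr1; apply: ideal_power_mul => //; apply: ideal_power_all. Qed.

Lemma pow_mul m n a b : Jp m a -> Jp n b -> Jp (m + n) (a * b).
Proof.
move=> H; elim: H b => [a' b|m' b|m' a' a'' _ IHa _ IHb b|m' a' a'' Ja _ IH b] Jb.
- exact: powMl.
- by rewrite mul0r; apply: ideal_power_zero.
- by rewrite mulrDl; apply: ideal_power_add; auto.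
- by rewrite addSn -mulrA; apply: ideal_power_mul; auto.
Qed.

Lemma powMr n a b : Jp n a -> Jp n (a * b).
Proof. by move=> Ja; have := pow_mul Ja (ideal_power_all J b); rewrite addn0. Qed.

Lemma powN n a : Jp n a -> Jp n (- a).
Proof. by move=> Ja; rewrite -mulN1r; apply: powMl. Qed.
Lemma powB n a b : Jp n a -> Jp n b -> Jp n (a - b).
Proof. by move=> Ja Jb; apply: ideal_power_add => //; apply: powN. Qed.

Lemma pow_leq m n a : (m <= n)%N -> Jp n a -> Jp m a.
Proof.
move=> le_mn; rewrite -(subnK le_mn); elim: (n - m)%N a => // d IH a.
rewrite addSn; apply: pow_ind => [|x y|x y _ Jy].
- exact: ideal_power_zero.
- exact: ideal_power_add.
- by apply: powMl; apply: IH.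
Qed.

Lemma pow_rad n a : (0 < n)%N -> Jp n a -> J a.
Proof.
move=> n0 /(pow_leq n0); apply: pow_ind => [|x y|x y Jx _].
- exact: (rad0 S).
- exact: (radD S).
- exact: (radMr S).
Qed.

Lemma pow_rad1 a : Jp 1 a -> J a. Proof. exact: pow_rad. Qed.

(** Expresses [J^(m+n) = J^m J^n] as an induction principle: a closed predicate need only be checked
    on products. *)
Lemma pow_add_ind m n (P : R -> Prop) : P 0 -> (forall a b, P a -> P b -> P (a + b)) ->
  (forall a b, Jp m a -> Jp n b -> P (a * b)) -> forall a, Jp (m + n) a -> P a.
Proof.
elim: m P => [|m IH] P P0 PD PM a.
  by rewrite -[a]mul1r => Ja; apply: PM => //; [apply: ideal_power_all | rewrite -[a]mul1r].
rewrite addSn; move: a; apply: pow_ind => // a b Ja; move: b.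
apply: (IH (fun b => P (a * b))) => [|x y Px Py|x y Jx Jy].
- by rewrite mulr0.
- by rewrite mulrDr; apply: PD.
- by rewrite mulrA; apply: PM => //; apply: ideal_power_mul.
Qed.

Lemma pow_exp a n : J a -> Jp n (a ^+ n).
Proof.
move=> Ja; elim: n => [|n IH]; first exact: ideal_power_all.
by rewrite exprS; apply: ideal_power_mul.
Qed.

Lemma rad_nilpotent a : J a -> exists n, a ^+ n = 0.
Proof. by have [n Jn] := rad_nil S => Ja; exists n; apply/Jn/pow_exp. Qed.

(** Iterating gives [x = a^n x], and [a] is nilpotent. *)
Lemma rad_fixed a x : J a -> x = a * x -> x = 0.
Proof.
move=> Ja ax; have [n an] := rad_nilpotent Ja.
have H m : x = a ^+ m * x.
  by elim: m => [|m IH]; rewrite ?expr0 ?mul1r // exprS -mulrA -IH.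
by rewrite (H n) an mul0r.
Qed.

Lemma one_sub_inv a : J a -> exists b, b * (1 - a) = 1 /\ (1 - a) * b = 1.
Proof.
(* The inverse is the finite geometric series in [a]. *)
case/rad_nilpotent=> n an; exists (\sum_(i < n) a ^+ i).
have E : (1 - a) * (\sum_(i < n) a ^+ i) = 1.
  by rewrite -[_ * _]opprK -mulNr opprB -subrX1 an sub0r opprK.
split=> //; rewrite -[RHS]E mulr_suml mulr_sumr.
by apply: eq_bigr => i _; rewrite mulrBr mulrBl mulr1 mul1r -exprSr -exprS.
Qed.

Lemma scal_add_inv c a : c != 0 -> J a ->
  exists b, b * (s c + a) = 1 /\ (s c + a) * b = 1.
Proof.
move=> c0 Ja; have [b [b1 b2]] := one_sub_inv (radN (radMl S (s c^-1) Ja)).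
have Ec : s c^-1 * s c = 1 by rewrite -(scalM S) mulVf // (scal1 S).
have Ec' : s c * s c^-1 = 1 by rewrite -(scalM S) mulfV // (scal1 S).
have E : s c + a = s c * (1 - - (s c^-1 * a)).
  by rewrite opprK mulrDr mulr1 mulrA Ec' mul1r.
exists (b * s c^-1); rewrite E; split.
  by rewrite -mulrA [X in b * X]mulrA Ec mul1r.
by rewrite -mulrA [X in s c * X]mulrA b2 mul1r.
Qed.

(** Since [R/J] is split, a ring element acts on a homogeneous element as a scalar plus a radical
    element. If the scalar is nonzero the action is invertible, which drives most case distinctions
    below. *)
Lemma lactE a i x : e i * x = x -> exists c j, J j /\ a * x = s c * x + j * x.
Proof.
move=> ex; have [c Jc] := idem_local S a i; exists c, (a * e i - s c * e i).
by split=> //; rewrite mulrBl -!mulrA ex addrC subrK.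
Qed.

Lemma idem_local_neq i j a : i != j -> J (e i * a * e j).
Proof.
move=> ij; have [c Jc] := idem_local S a j.
have := radMl S (e i) Jc; rewrite mulrBr [e i * (s c * _)]mulrA -(scalC S).
by rewrite -[s c * _ * _]mulrA idem_neq // mulr0 subr0 mulrA.
Qed.

(** Splits [e_i a] into its diagonal component, governed by the left axiom, and the components
    [e_i a e_j] with [j] different from [i], which lie in [J]. *)
Lemma idem_local_r a i : exists c, J (e i * a - s c * e i).
Proof.
have [c Jc] := idem_local S a i; exists c.
have -> : e i * a - s c * e i =
    e i * (a * e i - s c * e i) + \sum_(j | j != i) e i * a * e j.
  rewrite -{1}[a]mulr1 -(idem_sum S) mulr_sumr mulr_sumr (bigD1 i) //=.
  rewrite mulrBr [e i * (s c * _)]mulrA -(scalC S) -mulrA idem_id addrAC; congr (_ + _).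
  by apply: eq_bigr => j _; rewrite mulrA.
apply: (radD S); first exact: (radMl S).
by apply: rad_sum => j ji; apply: idem_local_neq; rewrite eq_sym.
Qed.

Lemma ractE a i x : x * e i = x -> exists c j, J j /\ x * a = x * s c + x * j.
Proof.
move=> ex; have [c Jc] := idem_local_r a i; exists c, (e i * a - s c * e i).
by split=> //; rewrite mulrBr mulrA ex (scalC S) mulrA ex addrC subrK.
Qed.

Lemma split_left x : x = \sum_i e i * x.
Proof. by rewrite -mulr_suml (idem_sum S) mul1r. Qed.
Lemma split_right x : x = \sum_i x * e i.
Proof. by rewrite -mulr_sumr (idem_sum S) mulr1. Qed.

Lemma unit_left (a b x y : R) : b * a = 1 -> y = a * x -> x = b * y.
Proof. by move=> ba ->; rewrite mulrA ba mul1r. Qed.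

Lemma scal_inj_mod c (x : R) (P : R -> Prop) : (forall a y, P y -> P (a * y)) ->
  P (s c * x) -> ~ P x -> c = 0.
Proof.
move=> PM Pc nP; have [//|c0] := eqVneq c 0; case: nP.
by have := PM (s c^-1) _ Pc; rewrite mulrA -(scalM S) mulVf // (scal1 S) mul1r.
Qed.

(** In a uniserial [R x], any element of [J^n x] outside [J^(n+1) x] generates [J^n x]: if it were a
    multiple of some [b x] by a factor without scalar part, it would drop one layer. *)
Lemma pow_cyclic x n d y : left_uniserial x -> Jp n d -> y = d * x ->
  ~ (exists2 d', Jp n.+1 d' & y = d' * x) ->
  forall b, Jp n b -> exists c, b * x = c * y.
Proof.
move=> ux Jd -> ny b Jb.
rewrite (split_left (b * x)); elim/big_ind: _ => [|z z' [c ->] [c' ->]|i _].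
- by exists 0; rewrite mul0r.
- by exists (c + c'); rewrite mulrDl.
rewrite mulrA; have [c [->|E]] := ux (e i * b) d; first by exists c.
have [|g [j [Jj]]] := @lactE c i (e i * b * x); first by rewrite -mulrA mulrA idem_id.
rewrite -E -mulrDl => Eg; have [g0|g0] := eqVneq g 0; last first.
  have [c' [c'1 _]] := scal_add_inv g0 Jj.
  by exists c'; apply: unit_left Eg.
case: ny; exists (j * (e i * b)); last by rewrite Eg g0 scal0 add0r !mulrA.
by apply: ideal_power_mul => //; apply: powMl.
Qed.

Lemma powr_cyclic w n d : right_uniserial w -> Jp n d ->
  ~ (exists2 d', Jp n.+1 d' & w * d = w * d') ->
  forall b, Jp n b -> exists c, w * b = w * d * c.
Proof.
move=> uw Jd ny b Jb; rewrite (split_right b) mulr_sumr.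
elim/big_ind: _ => [|z z' [c ->] [c' ->]|i _].
- by exists 0; rewrite mulr0.
- by exists (c + c'); rewrite mulrDr.
have [c [->|E]] := uw (b * e i) d; first by exists c.
have [|g [j [Jj]]] := @ractE c i (w * (b * e i)); first by rewrite -!mulrA idem_id.
rewrite -E -mulrDr => Eg; have [g0|g0] := eqVneq g 0; last first.
  have [c' [_ c'1]] := scal_add_inv g0 Jj.
  by exists c'; rewrite Eg -mulrA c'1 mulr1.
case: ny; exists (b * e i * j); last by rewrite Eg g0 scal0 add0r !mulrA.
by rewrite -addn1; apply: pow_mul; [apply: powMr|apply: pow1].
Qed.

Lemma powr_cyclic_add w p d n : (forall b, Jp d b -> exists c, w * b = w * p * c) ->
  forall b, Jp (d + n) b -> exists2 c, Jp n c & w * b = w * p * c.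
Proof.
move=> H; apply: pow_add_ind => [|a b [c Jc Ec] [c' Jc' Ec']|a b Ja Jb].
- by exists 0; [apply: ideal_power_zero|rewrite !mulr0].
- by exists (c + c'); [apply: ideal_power_add|rewrite !mulrDr Ec Ec'].
have [c Ec] := H a Ja; exists (c * b); first exact: powMl.
by rewrite !mulrA Ec.
Qed.

(** An element of [R v] with nonzero scalar part generates [R v]; the others lie in [J v], where
    uniseriality of [R v'] applies. *)
Lemma left_uniserial_ext i v v' : e i * v = v -> left_uniserial v' ->
  (forall y, J y -> exists c, y * v = c * v') -> left_uniserial v.
Proof.
move=> ev uv' H a b.
have [g [j [Jj Ea]]] := lactE a ev; have [g' [j' [Jj' Eb]]] := lactE b ev.
have [g0|g0] := eqVneq g 0; last first.
  have [c [c1 _]] := scal_add_inv g0 Jj; exists (b * c); right.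
  by rewrite -mulrA Ea -mulrDl [c * _]mulrA c1 mul1r.
have [g'0|g'0] := eqVneq g' 0; last first.
  have [c [c1 _]] := scal_add_inv g'0 Jj'; exists (a * c); left.
  by rewrite -mulrA Eb -mulrDl [c * _]mulrA c1 mul1r.
rewrite Ea Eb g0 g'0 scal0 !mul0r !add0r.
by have [d ->] := H j Jj; have [d' ->] := H j' Jj'; apply: uv'.
Qed.

Lemma nakayama (X : R -> Prop) m : X 0 -> (forall x y, X x -> X y -> X (x + y)) ->
  (forall a x, X x -> X (a * x)) ->
  (forall y, J y -> exists2 z, Jp 2 z & X (y * m - z * m)) ->
  forall y, J y -> X (y * m).
Proof.
move=> X0 XD XM H y Jy; have [N JN] := rad_nil S.
(* The hypothesis pushes the error term from [J^(n+1)] to [J^(n+2)], until nilpotency removes it. *)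
suff K n : exists2 z, Jp n.+1 z & X (y * m - z * m).
  have [z Jz] := K N; rewrite (JN z); first by rewrite mul0r subr0.
  by apply: pow_leq Jz.
elim: n => [|n [z Jz Xz]].
  by exists y; [apply: pow1 | rewrite subrr].
suff [z' Jz' Xz'] : exists2 z', Jp n.+2 z' & X (z * m - z' * m).
  by exists z' => //; rewrite -[y * m](subrK (z * m)) -addrA; apply: XD.
move: Jz; rewrite -addn1 => Jz; move: z Jz {Xz}.
apply: pow_add_ind => [|a b [a' Ja Xa] [b' Jb Xb]|a b Ja Jb].
- by exists 0; [apply: ideal_power_zero | rewrite subrr].
- exists (a' + b'); first exact: ideal_power_add.
  by rewrite !mulrDl opprD addrACA; apply: XD.
- have [z Jz Xz] := H b (pow_rad1 Jb); exists (a * z).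
    by have := pow_mul Ja Jz; rewrite addn2 addn1.
  by rewrite -!mulrA -mulrBr; apply: XM.
Qed.

End SplitBasic.

Definition left_good (R : pzRingType) (V : Type) (e : V -> R) (J : R -> Prop) (x : R) :=
  exists i y, [/\ J y, e i * y = y & forall u, J u -> exists a, u * x = a * (y * x)].

(** * Uniserial generators *)

Section Uniserial.
Variables (k : fieldType) (V : finType) (R : pzRingType).
Variables (s : k -> R) (e : V -> R) (J : R -> Prop).
Hypothesis S : split_basic s e J.

Notation Jp := (ideal_power J).
Notation arr := (radical_arrow e J).
Notation span := (radical_span e J).

(* One of the two generators [x], [x'] can serve as the multiplier in
   [left_good]: otherwise [J g = J J g]. *)
Lemma good_next g i l x x' : arr i l g -> left_good e J g ->
  J x -> J x' -> span i x x' ->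
  exists2 h, h = x \/ h = x' & forall u, J u -> exists a, u * g = a * (h * g).
Proof.
move=> [_ eg _] [m [y [Jy ey Hy]]] Jx Jx' Hx; have [a [b Eab]] := Hx y Jy.
have Eyg : y * g = a * (x * g) + b * (x' * g).
  by rewrite !mulrA -mulrDl -Eab -mulrA eg.
have key h : J h -> (forall u, J u -> exists a, u * g = a * (h * g)) \/
    exists2 j, J j & h * g = j * (y * g).
  move=> Jh; have [c Ec] := Hy h Jh.
  have [|c1 [j [Jj]]] := @lactE _ _ _ _ _ _ S c m (y * g); first by rewrite mulrA ey.
  rewrite -Ec -mulrDl => Eh; have [c0|c0] := eqVneq c1 0.
    by right; exists j => //; rewrite Eh c0 (scal0 S) add0r.
  have [d [d1 _]] := scal_add_inv S c0 Jj; left=> u /Hy [v ->].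
  by exists (v * d); rewrite -mulrA Eh [d * _]mulrA d1 mul1r.
have [H|[j Jj Ex]] := key x Jx; first by exists x; [left|].
have [H|[j' Jj' Ex']] := key x' Jx'; first by exists x'; [right|].
have y0 : y * g = 0.
  apply: (rad_fixed S (a := a * j + b * j')).
    by apply: (radD S); apply: (radMl S).
  by rewrite {1}Eyg Ex Ex' (mulrA a) (mulrA b) -mulrDl.
exists x; first by left.
by move=> u /Hy [v ->]; exists 0; rewrite y0 mulr0 mul0r.
Qed.

(** For good [g], [J g] is generated by [h g] with [h] again good, so repeated passage to the
    radical meets only cyclic modules. *)
Lemma good_span_uniserial :
  (forall l, exists i x i' x', [/\ arr i l x /\ arr i' l x', span l x x',
     left_good e J x & left_good e J x']) ->
  forall l, exists i x i' x', [/\ arr i l x /\ arr i' l x', span l x x',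
     left_uniserial x & left_uniserial x'].
Proof.
move=> H; have [N JN] := rad_nil S.
(* The right factor [h] collects the generators already passed; the next stage concerns [y] with
   right factor [g h], and [n] bounds the Loewy length. *)
suff K n i l g h : arr i l g -> left_good e J g ->
    (forall b, Jp n b -> b * (g * h) = 0) -> left_uniserial (g * h).
  have L i l g : arr i l g -> left_good e J g -> left_uniserial g.
    by move=> ag gg; rewrite -[g]mulr1; apply: (K N) ag gg _ => b /JN ->; rewrite mul0r.
  move=> l; have [i [x [i' [x' [[ax ax'] sx gx gx']]]]] := H l.
  by exists i, x, i', x'; split=> //; [apply: L ax gx|apply: L ax' gx'].
elim: n => [|n IH] in i l g h * => ag gg gh0.
  have g0 : g * h = 0 by rewrite -[LHS]mul1r gh0 //; apply: ideal_power_all.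
  by move=> a b; exists 0; left; rewrite g0 !mulr0.
have [m [x [m' [x' [[ax ax'] sx gx gx']]]]] := H i.
have [y Ey Hy] := good_next ag gg (let: And3 j _ _ := ax in j)
   (let: And3 j _ _ := ax' in j) sx.
have [q [aq gq]] : exists q, arr q i y /\ left_good e J y.
  by case: Ey => ->; [exists m|exists m'].
have [Jy _ _] := aq; have [_ eg _] := ag.
apply: (left_uniserial_ext S (i := i) (v' := y * (g * h))) => [||u Ju].
- by rewrite mulrA eg.
- apply: IH aq gq _ => b Jb; rewrite mulrA; apply: gh0.
  by have := pow_mul S Jb (pow1 Jy); rewrite addn1.
- by have [c Ec] := Hy u Ju; exists c; rewrite !mulrA Ec mulrA.
Qed.

(** The layer [J^n x] of the radical series of [R x]. *)
Definition orbit_power n x y := exists2 b, Jp n b & y = b * x.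
Notation rl := orbit_power.

Lemma orbit0 n x : rl n x 0.
Proof. by exists 0; [apply: ideal_power_zero|rewrite mul0r]. Qed.
Lemma orbitD n x y y' : rl n x y -> rl n x y' -> rl n x (y + y').
Proof.
move=> [b Jb ->] [b' Jb' ->]; exists (b + b'); last by rewrite mulrDl.
exact: ideal_power_add.
Qed.
Lemma orbit_mul m n x a y : Jp m a -> rl n x y -> rl (m + n) x (a * y).
Proof.
by move=> Ja [b Jb ->]; exists (a * b); [apply: (pow_mul S)|rewrite mulrA].
Qed.
Lemma orbitMl n x a y : rl n x y -> rl n x (a * y).
Proof. by apply: (@orbit_mul 0); apply: ideal_power_all. Qed.
Lemma orbitS n x a y : J a -> rl n x y -> rl n.+1 x (a * y).
Proof. by move=> Ja; apply: (@orbit_mul 1); apply: pow1. Qed.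
Lemma orbitN n x y : rl n x y -> rl n x (- y).
Proof. by rewrite -mulN1r; apply: orbitMl. Qed.
Lemma orbitB n x y y' : rl n x y -> rl n x y' -> rl n x (y - y').
Proof. by move=> H H'; apply: orbitD => //; apply: orbitN. Qed.
Lemma orbit_leq m n x y : (m <= n)%N -> rl n x y -> rl m x y.
Proof. by move=> le_mn [b Jb ->]; exists b => //; apply: (pow_leq S) Jb. Qed.
Lemma orbit_base n x b : Jp n b -> rl n x (b * x).
Proof. by exists b. Qed.

Lemma orbit_shift m n n' x x' : (forall y, rl n x y -> rl n' x' y) ->
  forall y, rl (m + n) x y -> rl (m + n') x' y.
Proof.
move=> H _ [b Jb ->].
apply: (pow_add_ind (P := fun b => rl (m + n') x' (b * x)) _ _ _ Jb) => [|a c|a c Ja Jc].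
- by rewrite mul0r; apply: orbit0.
- by rewrite mulrDl; apply: orbitD.
- by rewrite -mulrA; apply: orbit_mul => //; apply/H/orbit_base.
Qed.

(** Equality of consecutive layers propagates to all later ones, and these are eventually zero. *)
Lemma orbit_stable n x : (forall y, rl n x y -> rl n.+1 x y) ->
  forall y, rl n x y -> y = 0.
Proof.
move=> H y ry; have [N JN] := rad_nil S.
have K m : rl (m + n) x y.
  by elim: m => // m IH; rewrite addSnnS; apply: (orbit_shift H).
by have [b Jb ->] := orbit_leq (leq_addr n N) (K N); rewrite (JN b Jb) mul0r.
Qed.

(** The right-hand counterpart at [i]: [e_i J = w R + w' R] with both summands uniserial. *)
Definition right_span_at i := exists w w',
  [/\ [/\ J w, e i * w = w & right_uniserial w],
      [/\ J w', e i * w' = w' & right_uniserial w'] &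
      forall y, J y -> exists a b, e i * y = w * a + w' * b].

Hypothesis right_span : forall i, right_span_at i.

(** The right uniserial generators [w] generate [J] as a right ideal, and [w a t] is a scalar
    multiple of [w t] up to [J^2 t]; if every [w t] were in [Q], so would be [J t]. *)
Lemma right_arrow_outside i t (Q : R -> Prop) : e i * t = t -> Q 0 ->
  (forall y z, Q y -> Q z -> Q (y + z)) -> (forall a y, Q y -> Q (a * y)) ->
  (forall b, Jp 2 b -> Q (b * t)) -> ~ (forall y, J y -> Q (y * t)) ->
  exists m w, [/\ J w, e m * w = w, right_uniserial w & ~ Q (w * t)].
Proof.
move=> et Q0 QD QM Q2 nQ; apply: contrapT => nex; apply: nQ => y Jy.
have QW m w a : J w -> e m * w = w -> right_uniserial w -> Q (w * a * t).
  move=> Jw ew uw; have Qw : Q (w * t) by apply: contrapT => nQ; apply: nex; exists m, w.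
  have [c [j [Jj Ea]]] := lactE S a et; rewrite -mulrA Ea mulrDr mulrA -(scalC S) -mulrA.
  apply: QD; first exact: QM.
  by rewrite mulrA; apply: Q2; apply: ideal_power_mul => //; apply: pow1.
rewrite (split_left S y) mulr_suml.
apply: (big_ind Q) => // m _.
have [w [w' [[Jw ew uw] [Jw' ew' uw'] H]]] := right_span m.
by have [a [b ->]] := H y Jy; rewrite mulrDl; apply: QD; [apply: QW ew uw|apply: QW ew' uw'].
Qed.

End Uniserial.

(** * The intersection of the two uniserial submodules *)

Section Intersection.
Variables (k : fieldType) (V : finType) (R : pzRingType).
Variables (s : k -> R) (e : V -> R) (J : R -> Prop).
Hypothesis S : split_basic s e J.
Hypothesis right_span : forall i, right_span_at e J i.

Notation Jp := (ideal_power J).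
Notation arr := (radical_arrow e J).
Notation span := (radical_span e J).
Notation rl := (orbit_power J).

Lemma orbit_proper n x : ~ (forall y, rl n x y -> y = 0) ->
  exists i b, [/\ Jp n b, e i * b = b & ~ rl n.+1 x (b * x)].
Proof.
move=> nz; apply: contrapT => nex; apply/nz/(orbit_stable S) => _ [b Jb ->].
rewrite (split_left S b) mulr_suml; apply: (big_ind (rl n.+1 x)).
- exact: orbit0.
- by move=> y y'; apply: orbitD.
move=> i _; apply: contrapT => nr; apply: nex; exists i, (e i * b); split=> //.
  exact: (powMl S).
by rewrite mulrA (idem_id S).
Qed.

(** Produces the multiplier [w] and the comparison element [z = r x']. Both sides of the
    intersection are compared inside the chain of right submodules of [w R]. *)
Lemma meet_generator x x' i m p d d' :
  left_uniserial x -> (d <= d')%N ->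
  e i * x = x -> Jp d p -> e m * p = p -> p * e i = p -> ~ rl d.+1 x (p * x) ->
  (forall y, rl d x y <-> rl d' x' y) -> ~ (forall y, rl d.+1 x y -> y = 0) ->
  exists n w r,
  [/\ [/\ J w, e n * w = w, right_uniserial w & ~ rl d.+2 x (w * (p * x))],
      forall b, Jp d b -> exists c, w * b = w * p * c,
      Jp (d' - d) r /\ e i * r = r,
      w * (p * (r * x')) = w * (p * x) &
      exists2 j, J j & p * (r * x') = p * x + j * (p * x)].
Proof.
move=> ux le_dd' ex Jpp ep pe npx HW nz; set t := p * x.
have et : e m * t = t by rewrite mulrA ep.
have Wt y : rl d x y -> exists c, y = c * t.
  case=> b Jb ->; apply: (pow_cyclic S ux Jpp erefl _ Jb).
  by case=> d1 Jd1 E; apply: npx; exists d1.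
have pow_t b : Jp 2 b -> rl d.+2 x (b * t).
  by move=> Jb; have := orbit_mul S Jb (orbit_base x Jpp).
have [n [w [Jw ew uw nwt]]] : exists n w,
    [/\ J w, e n * w = w, right_uniserial w & ~ rl d.+2 x (w * t)].
  apply: (right_arrow_outside S right_span (Q := rl d.+2 x) et) => //.
  - exact: orbit0.
  - by move=> *; apply: orbitD.
  - by move=> a y; apply: (orbitMl S).
  move=> nQ; apply/nz/(orbit_stable S) => _ [b Jb ->].
  apply: (pow_add_ind (m := 1) (n := d) (P := fun b => rl d.+2 x (b * x)) _ _ _ Jb).
  - by rewrite mul0r; apply: orbit0.
  - by move=> b1 b2; rewrite mulrDl; apply: orbitD.
  move=> a c /(pow_rad1 S) Ja Jc; rewrite -mulrA.
  have [c' ->] := Wt _ (orbit_base x Jc); rewrite mulrA; apply: nQ.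
  exact: (radMr S).
have wJ b y : Jp d.+1 b -> y = b * x -> rl d.+2 x (w * y).
  by move=> Jb ->; apply/(orbitS S Jw)/orbit_base.
(* If [w p] were in [w J^(d+1)], then [w t] would be in [J^(d+2) x]. *)
have Hw : forall b, Jp d b -> exists c, w * b = w * p * c.
  apply: (powr_cyclic S uw Jpp) => -[b Jb E]; apply: nwt.
  by rewrite /t mulrA E -mulrA; apply: wJ Jb _.
have [q Jq tq] : rl d' x' t by apply/HW/orbit_base.
have [r Jr Er] : exists2 c, Jp (d' - d) c & w * q = w * p * c.
  by apply: (powr_cyclic_add S Hw); rewrite subnKC.
(* Making [r] homogeneous changes nothing after multiplication by [p], because [p e_i = p]. *)
exists n, w, (e i * r).
have wpz : w * (p * (e i * r * x')) = w * t.
  by rewrite tq !mulrA -[w * p * _]mulrA pe Er.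
split=> //; first by rewrite mulrA (idem_id S); split=> //; apply: (powMl S).
have [|c Ec] := Wt (p * (e i * r * x')).
  apply/HW; exists (p * (e i * r)); last by rewrite mulrA.
  by rewrite -(subnKC le_dd'); apply: (pow_mul S) => //; apply: (powMl S).
have [g [j [Jj]]] := lactE S c et; rewrite -Ec => Ez; exists j => //.
(* Multiplying [p z = (g + j) t] by [w] puts [(1 - g) w t] in [J^(d+2) x], which forces [g = 1]. *)
rewrite Ez; congr (_ + _); suff -> : g = 1 by rewrite (scal1 S) mul1r.
apply/eqP; rewrite eq_sym -subr_eq0; apply/eqP.
apply: (scal_inj_mod S (x := w * t) (P := rl d.+2 x)) nwt => [a y|].
  exact: (orbitMl S).
rewrite (scalB S) (scal1 S) mulrBl mul1r -{1}wpz Ez mulrDr.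
rewrite [w * (s g * t)]mulrA -(scalC S) -[s g * w * t]mulrA addrAC subrr add0r.
by apply/(orbitS S Jw)/(orbitS S Jj)/orbit_base.
Qed.

(** Unlike in [lactE], one scalar and one radical element serve all [x] in [e_i R] at once. *)
Lemma idem_local_act a i : exists c j,
  J j /\ forall x, e i * x = x -> a * x = s c * x + j * x.
Proof.
have [c Jc] := idem_local S a i; exists c, (a * e i - s c * e i); split=> // x ex.
by rewrite mulrBl -!mulrA ex addrC subrK.
Qed.

Lemma left_uniserial_mul (a x : R) : left_uniserial x -> left_uniserial (a * x).
Proof. by move=> ux b c; rewrite !mulrA; apply: ux. Qed.

Lemma right_uniserial_mul (w a : R) : right_uniserial w -> right_uniserial (w * a).
Proof. by move=> uw b c; have [d H] := uw (a * b) (a * c); exists d; rewrite -!(mulrA w a). Qed.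

(** Steinitz exchange modulo [J^2]: one of the two coefficients of [x] has a nonzero scalar part, so
    [x] can replace that generator. *)
Lemma span_exchange q i y y' i1 i2 x : arr i1 i y -> arr i2 i y' -> span i y y' ->
  arr q i x -> ~ Jp 2 x -> exists2 x', J x' & span i x x'.
Proof.
move=> [Jy ey ye] [Jy' ey' ye'] Hy [Jx ex xe] nx.
have [a [b]] := Hy x Jx; rewrite xe.
have [c [j [Jj ->]]] := lactE S a ey; have [c' [j' [Jj' ->]]] := lactE S b ey'.
have span_of v v' u : J u -> (exists a b, v = a * x + b * u) ->
    (exists a b, v' = a * x + b * u) -> span i v v' -> span i x u.
  move=> Ju [a1 [b1 Ev]] [a2 [b2 Ev']] H z /H [f [g ->]].
  exists (f * a1 + g * a2), (f * b1 + g * b2).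
  by rewrite Ev Ev' !mulrDr !mulrDl !mulrA addrACA.
have self u : exists a b, u = a * x + b * u by exists 0, 1; rewrite mul0r mul1r add0r.
have [->|c0] := eqVneq c 0; last first.
  have [d [d1 _]] := scal_add_inv S c0 Jj; rewrite -!mulrDl => E.
  exists y' => //; apply: span_of Hy => //; exists d, (- (d * (s c' + j'))).
  by rewrite {1}E mulrDr !mulrA d1 mul1r mulNr addrK.
have [->|c'0] := eqVneq c' 0; last first.
  have [d [d1 _]] := scal_add_inv S c'0 Jj'; rewrite -!mulrDl => E.
  exists y => //; apply: span_of Hy => //; exists d, (- (d * (s 0 + j))).
  by rewrite {1}E mulrDr !mulrA d1 mul1r mulNr addrC addKr.
rewrite (scal0 S) !mul0r !add0r => E; case: nx; rewrite E.
by apply: ideal_power_add; apply: ideal_power_mul => //; apply: pow1.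
Qed.

(** The numbers [n] and [n'] bound the Loewy lengths of [R x] and [R x']; their sum is the measure
    that decreases. *)
Definition uniserial_pair l n n' x x' :=
  [/\ exists i, arr i l x, exists i', arr i' l x', span l x x',
      left_uniserial x /\ left_uniserial x' &
      (forall y, rl n x y -> y = 0) /\ (forall y, rl n' x' y -> y = 0)].

(** The intersection is [J x], and [x] is replaced by [x1 = x - z]. Since [J x1] falls into [J^2 x],
    the new generator is uniserial and shorter. *)
Lemma uniserial_pair_improve1 l n n' x x' d' : uniserial_pair l n n' x x' ->
  (0 < d')%N -> (forall y, rl 1 x y <-> rl d' x' y) ->
  ~ (forall y, rl 2 x y -> y = 0) ->
  exists m m' y y', uniserial_pair l m m' y y' /\ (m + m' < n + n')%N.
Proof.
move=> [[i ax] [i' ax'] sx [ux ux'] [x0 x'0]] d'0 HW nz.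
have [Jx ex xe] := ax; have [Jx' ex' xe'] := ax'.
have [m [p0 [Jp0 ep0 np0]]] : exists m b, [/\ Jp 1 b, e m * b = b & ~ rl 2 x (b * x)].
  by apply: orbit_proper => H; apply: nz => y /(orbit_leq S (m := 1)) - /(_ isT) /H.
have [p [Jpp ep pe npx]] : exists p, [/\ Jp 1 p, e m * p = p, p * e i = p &
    ~ rl 2 x (p * x)].
  exists (p0 * e i); split; [exact: (powMr S)|by rewrite mulrA ep0| |].
    by rewrite -mulrA (idem_id S).
  by rewrite -mulrA ex.
have [q [w [r [[Jw ew uw nwt] Hw [Jr er] wz [j Jj pz]]]]] :=
  meet_generator ux d'0 ex Jpp ep pe npx HW nz.
set t := p * x in nwt wz pz; have et : e m * t = t by rewrite mulrA ep.
have Wt y : rl 1 x y -> exists c, y = c * t.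
  case=> b Jb ->; apply: (pow_cyclic S ux Jpp erefl _ Jb).
  by case=> d1 Jd1 E; apply: npx; exists d1.
set z := r * x' in wz pz; have [x1 Ex1] : exists x1, x1 = x - z by exists (x - z).
have ex1 : e i * x1 = x1 by rewrite Ex1 mulrBr ex mulrA er.
have wpx1 : w * (p * x1) = 0 by rewrite Ex1 !mulrBr wz subrr.
have Jr1 a : J a -> Jp d' (a * r).
  by move=> Ja; have := pow_mul S (pow1 Ja) Jr; rewrite subnKC.
(* As [y x1] lies in [R t], it is [(g + j1) t]; the point is that multiplication by [w] shows
   [g = 0]. *)
have key y : J y -> rl 2 x (y * x1).
  move=> Jy; have [|c Ec] := Wt (y * x1).
    rewrite Ex1 mulrBr; apply: (orbitB S); first exact/orbit_base/pow1.
    by apply/HW; exists (y * r); [apply: Jr1|rewrite mulrA].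
  have [g [j1 [Jj1]]] := lactE S c et; rewrite -Ec => Ey.
  suff g0 : g = 0.
    by rewrite Ey g0 (scal0 S) mul0r add0r; apply/(orbitS S Jj1)/orbit_base.
  apply: (scal_inj_mod S (x := w * t) (P := rl 3 x)) nwt => [a u|].
    exact: (orbitMl S).
  have -> : s g * (w * t) = w * (y * x1) - w * (j1 * t).
    by rewrite Ey mulrDr addrK !mulrA (scalC S).
  apply: (orbitB S); last by apply/(orbitS S Jw)/(orbitS S Jj1)/orbit_base.
  (* Write [w y = w p c1]. The scalar part of [c1] contributes nothing because [w p x1 = 0], and its
     radical part lands in [J^3 x]. *)
  have [c1 Ec1] := Hw y (pow1 Jy); have [g1 [j2 [Jj2 Ec2]]] := lactE S c1 ex1.
  rewrite mulrA Ec1 -!mulrA Ec2 !mulrDr [p * (s g1 * _)]mulrA -(scalC S) -mulrA.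
  rewrite [w * (s g1 * _)]mulrA -(scalC S) -mulrA wpx1 mulr0 add0r.
  apply: (orbitS S Jw); rewrite Ex1 !mulrBr; apply: (orbitB S).
    apply: (orbitS S (pow_rad1 S Jpp)); exact/orbit_base/pow1.
  apply: (orbit_shift S (m := 1) (n := d') (n' := 1) (x := x')); first by move=> u /HW.
  apply: (orbit_mul S) => //; exists (j2 * r); [exact: Jr1|by rewrite mulrA].
have n2 : (2 < n)%N.
  by rewrite ltnNge; apply/negP => le_n2; apply: nz => y /(orbit_leq S le_n2) /x0.
exists n.-1, n', x1, x'; split; last by case: (n) n2.
split=> //.
- exists i; split=> //; first by rewrite Ex1; apply: (radB S) => //; apply: (radMl S).
  by rewrite Ex1 mulrBl xe -mulrA xe'.
- by exists i'.
- move=> y /sx [a [b ->]]; exists a, (a * r + b).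
  by rewrite Ex1 mulrBr mulrDl mulrA addrA subrK.
- split=> //; apply: (left_uniserial_ext S ex1 ux) => y /key [b _ ->]; by exists b.
(* [J^(n-1) x1 = J^(n-2) J x1] is contained in [J^n x = 0]. *)
split=> // y; have -> : n.-1 = (n - 2 + 1)%N.
    by case: (n) n2 => [|[|?]] //; rewrite subSS subSS subn0 addn1.
move=> ry; apply: x0; rewrite -(subnK (ltnW n2)); apply: (orbit_shift S _ ry) => u [b Jb ->].
exact/key/(pow_rad1 S).
Qed.

End Intersection.

(** * Shortening a pair whose intersection lies in the square of the radical *)

Section IntersectionHigher.
Variables (k : fieldType) (V : finType) (R : pzRingType).
Variables (s : k -> R) (e : V -> R) (J : R -> Prop).
Hypothesis S : split_basic s e J.
Hypothesis right_span : forall i, right_span_at e J i.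
Hypothesis left_span : forall l, exists i x i' x',
  [/\ radical_arrow e J i l x, radical_arrow e J i' l x' & radical_span e J l x x'].

Notation Jp := (ideal_power J).
Notation arr := (radical_arrow e J).
Notation span := (radical_span e J).
Notation rl := (orbit_power J).
Notation uniserial_pair := (uniserial_pair e J).

(** Rests on [J^2 e_l = J x + J x']. *)
Lemma rad_sub2_span l x x' (Q : R -> Prop) b : span l x x' -> Q 0 ->
  (forall y z, Q y -> Q z -> Q (y + z)) ->
  (forall a c, J a -> J c -> Q (a * x + c * x')) -> Jp 2 b -> Q (b * e l).
Proof.
move=> H Q0 QD Q1 Jb.
apply: (pow_add_ind (m := 1) (n := 1) (P := fun b => Q (b * e l)) _ _ _ Jb).
- by rewrite mul0r.
- by move=> c d; rewrite mulrDl; apply: QD.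
move=> a c /(pow_rad1 S) Ja /(pow_rad1 S) /H [u [v E]].
by rewrite -mulrA E mulrDr !mulrA; apply: Q1; apply: (radMr S).
Qed.

(** The generator is factored as [p = p' h] with [h] right uniserial, which turns [h z] into
    [h x a]. An invertible [a] forces [d = d'], and [x'] is replaced by [z - x a]. *)
Lemma uniserial_pair_improve2 l n n' x x' d d' : uniserial_pair l n n' x x' ->
  (1 < d)%N -> (d <= d')%N -> (forall y, rl d x y <-> rl d' x' y) ->
  ~ (forall y, J y -> exists c, y * x = c * x') ->
  ~ (forall y, rl d.+1 x y -> y = 0) ->
  exists m m' y y', uniserial_pair l m m' y y' /\ (m + m' < n + n')%N.
Proof.
move=> [[i ax] [i' ax'] sx [ux ux'] [x0 x'0]] d1 le_dd' HW nV nz.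
have [Jx ex xe] := ax; have [Jx' ex' xe'] := ax'.
(* [Q] is the submodule [J^2 x + R x']; [h] will be chosen with [h x] outside it. *)
pose Q y := exists u c, rl 2 x u /\ y = u + c * x'.
have Q2 u : rl 2 x u -> Q u by move=> ru; exists u, 0; rewrite mul0r addr0.
have QV c : Q (c * x') by exists 0, c; rewrite add0r; split=> //; apply: orbit0.
have QD y z : Q y -> Q z -> Q (y + z).
  move=> [u [c [ru ->]]] [u' [c' [ru' ->]]]; exists (u + u'), (c + c').
  by rewrite mulrDl addrACA; split=> //; apply: orbitD.
have QM a y : Q y -> Q (a * y).
  move=> [u [c [ru ->]]]; exists (a * u), (a * c).
  by rewrite mulrDr mulrA; split=> //; apply: (orbitMl S).
have [q [h [[Jh qh hi] uh nQh]]] : exists q h, [/\ arr q i h, right_uniserial h & ~ Q (h * x)].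
  have [||q [w [Jw ew uw nQ]]] := right_arrow_outside S right_span ex (Q2 _ (orbit0 J 2 x)) QD QM.
  - by move=> b Jb; apply/Q2/orbit_base.
  - move=> H; apply: nV.
    (* If [J x] were inside [J^2 x + R x'], Nakayama would put it inside [R x'], against [nV]. *)
    apply: (nakayama S (X := fun y => exists c, y = c * x')) => [|y z [c ->] [c' ->]|a y [c ->]|].
    + by exists 0; rewrite mul0r.
    + by exists (c + c'); rewrite mulrDl.
    + by exists (a * c); rewrite mulrA.
    move=> y /H [u [c [[b Jb ->] ->]]]; exists b => //; exists c.
    by rewrite addrC addKr.
  exists q, (w * e i); split; last by rewrite -mulrA ex.
    split; [exact: (radMr S)|by rewrite mulrA ew|by rewrite -mulrA (idem_id S)].
  exact: right_uniserial_mul.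
have Hx : forall y, J y -> exists c, y * x = c * (h * x).
  move=> y /pow1; apply: (pow_cyclic S ux (pow1 Jh) erefl) => -[b Jb E].
  by apply/nQh/Q2; exists b.
(* [J^2 e_l = J x + J x'], so [h J^2 e_l] stays in [Q], while [h x] does not. *)
have nk2 b : Jp 2 b -> h * x <> h * b.
  move=> Jb E; apply: nQh; rewrite -xe mulrA E -mulrA.
  apply: (rad_sub2_span (Q := fun y => Q (h * y)) sx _ _ _ Jb).
  - by rewrite mulr0; apply/Q2/orbit0.
  - by move=> y z; rewrite mulrDr; apply: QD.
  move=> a c Ja Jc; rewrite mulrDr; apply: QD; last by rewrite mulrA.
  by rewrite mulrA; apply/Q2/orbit_base; apply: ideal_power_mul => //; apply: pow1.
have hJ b : J b -> exists c, h * b = h * x * c.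
  move=> /pow1; apply: (powr_cyclic S uh (pow1 Jx)) => -[c Jc]; exact: nk2.
(* Because [J x = R h x], the layer [J^d x] is [J^(d-1) h x]; a generator of it therefore has the
   form [p' h x]. *)
have [m [p' [Jp' mp' np']]] : exists m b,
    [/\ Jp d.-1 b, e m * b = b & ~ rl d.-1.+1 (h * x) (b * (h * x))].
  apply: (orbit_proper S) => H; apply: nz => y /(orbit_leq S (m := d)) - /(_ (leqnSn _)).
  case=> b; rewrite -(prednK (ltnW d1)) -addn1 => Jb ->.
  apply: (pow_add_ind (P := fun b => b * x = 0) _ _ _ Jb).
  - by rewrite mul0r.
  - by move=> u v; rewrite mulrDl => -> ->; rewrite addr0.
  move=> a c Ja /(pow_rad1 S) /Hx [u E]; rewrite -mulrA E mulrA; apply: H.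
  by apply: orbit_base; apply: (powMr S).
have [p [Ep Jpp mp pi]] : exists p, [/\ p = p' * h, Jp d p, e m * p = p & p * e i = p].
  exists (p' * h); split=> //; last by rewrite -mulrA hi.
    by have := pow_mul S Jp' (pow1 Jh); rewrite addn1 prednK // ltnW.
  by rewrite mulrA mp'.
have npx : ~ rl d.+1 x (p * x).
  rewrite Ep -mulrA => H; apply: np'; move: H; rewrite prednK 1?ltnW // -addn1 => H.
  have := orbit_shift S (n' := 0) (x' := h * x) _ H; rewrite addn0; apply.
  by move=> _ [b /(pow_rad1 S) /Hx [c ->] ->]; apply: orbit_base; apply: ideal_power_all.
have [q1 [w [r [[Jw ew uw nwt] Hw [Jr er] wz [j Jj pz]]]]] :=
  meet_generator S right_span ux le_dd' ex Jpp mp pi npx HW nz.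
have [t Et] : exists t, t = p * x by exists (p * x).
have [z Ez] : exists z, z = r * x' by exists (r * x').
rewrite -Et -?Ez in nwt wz pz npx; have mt : e m * t = t by rewrite Et mulrA mp.
have ez : e i * z = z by rewrite Ez mulrA er.
have ze : z * e l = z by rewrite Ez -mulrA xe'.
have Jz : J z by rewrite Ez; apply: (radMl S).
have [a0 Ea0] := hJ z Jz.
have [a [ea ae hz]] : exists a, [/\ e l * a = a, a * e l = a & h * z = h * x * a].
  exists (e l * a0 * e l); split; [by rewrite !mulrA (idem_id S)|by rewrite -!mulrA (idem_id S)|].
  by rewrite -ze mulrA Ea0 !mulrA -[h * x * e l]mulrA xe.
(* Multiply [h z = h x a] by [p'] and use [p z = (1 + j) t]. *)
have ta : t * a = (1 + j) * t.
  by rewrite mulrDl mul1r -pz Et Ep -!mulrA [h * (x * a)]mulrA -hz.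
have [j1 j1J] : exists b, b * (1 + j) = 1.
  have [b [b1 _]] := scal_add_inv S (oner_neq0 k) Jj; exists b.
  by move: b1; rewrite (scal1 S).
have [al [a1 [Ja1 Ea]]] : exists al a1, J a1 /\ a = s al * e l + a1.
  have [al Jal] := idem_local S a l; exists al, (a * e l - s al * e l).
  by split=> //; rewrite ae addrC subrK.
have xa : x * a = x * (s al + a1).
  by rewrite Ea !mulrDr [x * (s al * _)]mulrA -(scalC S) -mulrA xe (scalC S).
(* Without a scalar part [a] is nilpotent, and iterating [ta] gives [t = 0]. *)
have [al0|al0] := eqVneq al 0.
  have [N aN] : exists N, a ^+ N = 0.
    by apply: (rad_nilpotent S); rewrite Ea al0 (scal0 S) mul0r add0r.
  have H M : t = j1 ^+ M * (t * a ^+ M).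
    elim: M => [|M IH]; first by rewrite !expr0 mul1r mulr1.
    by rewrite exprSr exprS [t * _]mulrA ta -!mulrA [j1 * _]mulrA j1J mul1r.
  by case: npx; rewrite (H N) aN !mulr0; apply: orbit0.
have [b1 [_ b1r]] := scal_add_inv S al0 Ja1.
have hx : h * x = h * (z * b1).
  by rewrite mulrA hz -[h * x * a]mulrA xa -!mulrA b1r mulr1.
(* From here on [a] acts invertibly on [x]. So [h x] is [h z b1], which keeps [z] out of [J^2] and
   [r] out of [J]; hence [d' = d]. *)
have nJz : ~ Jp 2 z by move=> J2z; apply: nk2 hx; apply: (powMr S).
have nJr : ~ J r.
  by move=> Jr1; apply: nJz; rewrite Ez; apply: ideal_power_mul => //; apply: pow1.
have Edd : d' = d.
  apply/eqP; rewrite eqn_leq le_dd' andbT leqNgt; apply/negP => lt; apply: nJr.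
  by apply: (pow_rad S) Jr; rewrite subn_gt0.
subst d'; clear le_dd'.
(* The scalar part of [r] acting on [x'] is nonzero, so [z] and [x'] generate the same submodule. *)
have [rho [rho' [zE x'E]]] : exists rho rho', z = rho * x' /\ x' = rho' * z.
  have [c [u [Ju E]]] := lactE S r ex'; rewrite -Ez in E.
  have [c0|c0] := eqVneq c 0.
    case: nJz; rewrite E c0 (scal0 S) mul0r add0r.
    by apply: ideal_power_mul => //; apply: pow1.
  have [v [v1 _]] := scal_add_inv S c0 Ju; exists (s c + u), v.
  by rewrite E -mulrDl mulrA v1 mul1r.
have zx' m' y : rl m' z y -> rl m' x' y.
  by case=> b Jb ->; exists (b * rho); [apply: (powMr S)|rewrite zE mulrA].
have uz : left_uniserial z by rewrite zE; apply: left_uniserial_mul.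
have [x1 Ex1] : exists x1, x1 = z - x * a by exists (z - x * a).
have hx1 : h * x1 = 0 by rewrite Ex1 mulrBr mulrA hz subrr.
have ax1 : arr i l x1.
  rewrite Ex1; split; last by rewrite mulrBl ze -mulrA ae.
    by apply: (radB S) => //; apply: (radMr S).
  by rewrite mulrBr ez mulrA ex.
(* As [x a1] lies in [J^2 e_l], it is [g1 x + g2 z] with [g2] in [J]. Then
   [x1 = (1 - g2) z - (al + g1) x], which can be solved for [z]. *)
have sx1 : span l x x1.
  have [g1 [g2 [Jg2 Eg]]] : exists g1 g2, J g2 /\ x * a1 = g1 * x + g2 * z.
    have Jxa : Jp 2 (x * a1) by apply: ideal_power_mul => //; apply: pow1.
    have -> : x * a1 = x * a1 * e l.
      have Eal : a1 = a - s al * e l by rewrite Ea addrC addKr.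
      by rewrite -mulrA Eal mulrBl ae -mulrA (idem_id S).
    apply: (rad_sub2_span (Q := fun y => exists g1 g2, J g2 /\ y = g1 * x + g2 * z) sx _ _ _ Jxa).
    - by exists 0, 0; rewrite !mul0r addr0; split=> //; apply: (rad0 S).
    - move=> _ _ [g1 [g2 [H ->]]] [g3 [g4 [H' ->]]]; exists (g1 + g3), (g2 + g4).
      by rewrite !mulrDl addrACA; split=> //; apply: (radD S).
    move=> g1 g2 Jg1 Jg2; exists g1, (g2 * rho'); rewrite {1}x'E mulrA.
    by split=> //; apply: (radMr S).
  have [v [v1 _]] := one_sub_inv S Jg2.
  have Hz : z = v * (s al + g1) * x + v * x1.
    rewrite -[LHS]mul1r -v1 -!mulrA -mulrDr; congr (v * _).
    rewrite Ex1 xa mulrDr Eg -(scalC S) mulrBl mul1r [(_ + g1) * x]mulrDl.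
    by rewrite [s al * x + (_ + _)]addrA [RHS]addrCA opprD addNKr.
  move=> y /sx [u [v' ->]]; rewrite x'E Hz.
  exists (u + v' * rho' * (v * (s al + g1))), (v' * rho' * v).
  by rewrite !(mulrA, mulrDl, mulrDr) !addrA.
(* If [h z] were in [J^2 z], then [p z = p' h z], and with it [t], would lie in [J^(d+1) x'] and so
   in [J^(d+1) x]. *)
have Hz2 : forall y, J y -> exists c, y * z = c * (h * z).
  move=> y /pow1; apply: (pow_cyclic S uz (pow1 Jh) erefl) => -[b Jb E].
  apply: npx; have -> : t = j1 * (p * z) by rewrite pz -{2}[t]mul1r -mulrDl mulrA j1J mul1r.
  apply: (orbitMl S); rewrite Ep -mulrA E.
  apply: (orbit_shift S (m := 1) (n := d) (x := x')) => [y0 /HW //|].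
  apply: zx'; have := orbit_mul S Jp' (orbit_base z Jb).
  by rewrite addn2 prednK 1?ltnW.
(* [h] is not in [J^2], since [h x] is not in [J^2 x]; so it extends to a generating pair of
   [J e_i]. *)
have [h' Jh' sh] : exists2 h', J h' & span i h h'.
  have [i1 [y1 [i2 [y2 [ay1 ay2 sy]]]]] := left_span i.
  apply: (span_exchange S ay1 ay2 sy (x := h) (q := q)) => // J2h.
  by apply/nQh/Q2/orbit_base.
have [b Eb] := Hx h' Jh'; have [b' Eb'] := Hz2 h' Jh'.
have [be [j2 [Jj2 E2]]] : exists c j, J j /\ (b' - b) * (h * z) = s c * (h * z) + j * (h * z).
  by apply: (lactE S (b' - b) (i := q)); rewrite mulrA qh.
have hxa : h * (x * a) = h * z by rewrite mulrA -hz.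
have h'x1 : h' * x1 = (b' - b) * (h * z).
  by rewrite Ex1 mulrBr mulrA Eb' Eb -mulrA -[h * x * a]mulrA hxa mulrBl.
(* If [b' - b] is in [J], then [z - x a] generates a shorter module; otherwise
   evaluating [w p' (h' - b h) = w p c] at [x] and at [z] gives a contradiction. *)
have [be0|be0] := eqVneq be 0.
  (* Since [h x1 = 0], only the multiples of [h' x1] remain, and these lie in [J^2 z]. *)
  have key y : J y -> rl 2 z (y * x1).
    move=> Jy; have [_ ex1 _] := ax1; have [c [c' E]] := sh y Jy.
    rewrite -ex1 mulrA E mulrDl -!mulrA hx1 mulr0 add0r h'x1 E2 be0 (scal0 S) mul0r add0r.
    apply/(orbitMl S)/(orbitS S Jj2)/orbit_base; exact: pow1.
  have n2 : (1 < n')%N.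
    rewrite ltnNge; apply/negP => le_n2; apply: nz => y /(orbit_leq S (leqnSn _)) /HW.
    move=> ry; apply: x'0; apply: (orbit_leq S _ ry).
    exact: leq_trans le_n2 (ltnW d1).
  exists n, n'.-1, x, x1; split; last by rewrite ltn_add2l; case: (n') n2.
  split=> //.
  - by exists i.
  - by exists i.
  - split=> //; have [_ ex1 _] := ax1.
    by apply: (left_uniserial_ext S ex1 uz) => y /key [c _ ->]; exists c.
  (* [J^(n'-1) x1] is contained in [J^(n'-2) J^2 z], hence in [J^n' x' = 0]. *)
  split=> // y; have -> : n'.-1 = (n' - 2 + 1)%N.
    by case: (n') n2 => [|[|?]] //; rewrite subSS subSS subn0 addn1.
  move=> ry; apply: x'0; rewrite -(subnK n2); apply: zx'.
  apply: (orbit_shift S _ ry) => u [c Jc ->].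
  exact/key/(pow_rad1 S).
case/eqP: be0.
have [h1 [Eh1 Jh1]] : exists h1, h1 = h' - b * h /\ J h1.
  by exists (h' - b * h); split=> //; apply: (radB S) => //; apply: (radMl S).
have h1x : h1 * x = 0 by rewrite Eh1 mulrBl Eb mulrA subrr.
have h1z : h1 * z = s be * (h * z) + j2 * (h * z).
  by rewrite -E2 Eh1 !mulrBl Eb' -(mulrA b).
have [|c Ec] := Hw (p' * h1).
  by have := pow_mul S Jp' (pow1 Jh1); rewrite addn1 prednK // ltnW.
have [g [j3 [Jj3 Hg]]] := idem_local_act S c i.
have shift y : rl d.+2 z y -> rl d.+2 x y.
  by move=> /zx'; apply: (orbit_shift S (m := 2) (n := d)) => u /HW.
have wact v : e i * v = v -> w * (p' * (h1 * v)) = s g * (w * (p * v)) + w * (p * (j3 * v)).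
  move=> ev; rewrite [p' * _]mulrA [w * _]mulrA Ec -!mulrA Hg // !mulrDr; congr (_ + _).
  by rewrite [p * (s g * v)]mulrA -(scalC S) -mulrA [w * (s g * _)]mulrA -(scalC S) -mulrA.
have nwt' c0 : rl d.+2 x (s c0 * (w * t)) -> c0 = 0.
  by move=> H; apply: (scal_inj_mod S) H nwt => *; apply: (orbitMl S).
(* At [x] the left side vanishes because [h1 x = 0], which leaves [g w t] in [J^(d+2) x]. *)
have g0 : g = 0.
  apply: nwt'; have := wact x ex; rewrite h1x !mulr0 -Et => /esym/eqP.
  rewrite addr_eq0 => /eqP ->; apply: (orbitN S).
  apply/(orbitS S Jw); have := orbit_mul S Jpp (orbit_base x (pow1 Jj3)).
  by rewrite addn1.
apply: nwt'; have := wact z ez; rewrite g0 (scal0 S) mul0r add0r h1z.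
rewrite !mulrDr => E; have -> : s be * (w * t) = w * (p' * (s be * (h * z))).
  rewrite -wz Ep [p' * (s be * _)]mulrA -(scalC S) -[s be * p' * _]mulrA.
  rewrite [w * (s be * _)]mulrA -(scalC S).
  by rewrite -!mulrA.
rewrite -[X in rl _ _ X](addrK (w * (p' * (j2 * (h * z))))) E; apply: shift.
apply: (orbitB S); apply: (orbitS S Jw).
  by rewrite -addn1; apply/(orbit_mul S Jpp)/orbit_base/pow1.
have -> : d.+1 = (d.-1 + 2)%N by rewrite addn2 prednK // ltnW.
by apply: (orbit_mul S Jp'); apply/(orbitS S Jj2)/orbit_base/pow1.
Qed.

End IntersectionHigher.

(** * From uniserial generators to biseriality *)

Section UniserialBiserial.
Variables (k : fieldType) (V : finType) (R : pzRingType).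
Variables (s : k -> R) (e : V -> R) (J : R -> Prop).
Hypothesis S : split_basic s e J.

Notation Jp := (ideal_power J).
Notation arr := (radical_arrow e J).
Notation span := (radical_span e J).
Notation rl := (orbit_power J).
Notation uniserial_pair := (uniserial_pair e J).

Lemma uniserial_pairC l n n' x x' :
  uniserial_pair l n n' x x' -> uniserial_pair l n' n x' x.
Proof.
move=> [ax ax' sx [ux ux'] [x0 x'0]]; split=> // y /sx [a [b ->]].
by exists b, a; rewrite addrC.
Qed.

Lemma meet_orbit x x' n : left_uniserial x -> (forall y, rl n x y -> y = 0) ->
  ~ (exists c, x = c * x') ->
  exists2 d, ~ (forall y, rl d x y -> exists c, y = c * x') &
    forall y, rl d.+1 x y <-> (exists a, y = a * x) /\ (exists b, y = b * x').
Proof.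
move=> ux x0 nx; pose P d := forall y, rl d x y -> exists c, y = c * x'.
have [d [nPd Pd]] : exists d, ~ P d /\ P d.+1.
  apply: contrapT => nex; suff K d : ~ P d.
    by apply: (K n) => y /x0 ->; exists 0; rewrite mul0r.
  elim: d => [P0|d IH Pd]; last by apply: nex; exists d.
  by apply: nx; apply: P0; rewrite -[X in rl _ _ X]mul1r; apply/orbit_base/ideal_power_all.
exists d => // y; split=> [ry|[[a ya] yx']].
  by split; [case: ry => b _ ->; exists b|apply: Pd].
(* If [y] stopped at layer [m] with [m <= d], it would generate [J^m x], and [J^d x] would lie in
   [R x']. *)
have K m : (m <= d.+1)%N -> rl m x y.
  elim: m => [_|m IH lt_md]; first by rewrite ya; apply/orbit_base/ideal_power_all.
  have [b Jb yb] := IH (ltnW lt_md); apply: contrapT => nr.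
  apply: nPd => y' /(orbit_leq S (m := m)) - /(_ lt_md) [b' Jb' ->].
  have [|c ->] := pow_cyclic S ux Jb yb _ Jb'.
    by case=> b1 Jb1 E; apply: nr; exists b1.
  by have [c' ->] := yx'; exists (c * c'); rewrite mulrA.
exact: K.
Qed.

Hypothesis right_span : forall i, right_span_at e J i.
Hypothesis uniserial_span : forall l, exists i x i' x',
  [/\ arr i l x /\ arr i' l x', span l x x', left_uniserial x & left_uniserial x'].

(** Strong induction on the sum of the Loewy bounds: either [J] kills the intersection or a shorter
    pair exists. *)
Lemma uniserial_pair_biserial l n n' x x' :
  uniserial_pair l n n' x x' -> left_biserial_at e J l.
Proof.
have [N] := ubnP (n + n'); elim: N => // N IH in n n' x x' * => ltN.
have left_span j : exists i x i' x', [/\ arr i j x, arr i' j x' & span j x x'].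
  have [i [y [i' [y' [[ay ay'] sy _ _]]]]] := uniserial_span j.
  by exists i, y, i', y'.
have H0 j z : span j z 0 -> (exists i, arr i j z) -> left_uniserial z -> left_biserial_at e J j.
  move=> sz [i az] uz; exists i, z, j, 0; split=> //.
  - by split=> //; split; [exact: (rad0 S)|rewrite mulr0|rewrite mul0r].
  - by move=> a b; exists 0; left; rewrite !mulr0.
  - by move=> a b u ->; rewrite !mulr0.
(* Layer [d.+1] is the first one exactly for [d = 0], which selects the reduction to apply. *)
have step d d' m m' y y' : uniserial_pair l m m' y y' -> (m + m' < N.+1)%N ->
    (d <= d')%N -> (forall u, rl d.+1 y u <-> rl d'.+1 y' u) ->
    ~ (forall u, rl d y u -> exists c, u = c * y') ->
    ~ (forall u, rl d.+2 y u -> u = 0) -> left_biserial_at e J l.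
  move=> up lt le_d HW nd nz.
  have [m1 [m2 [y1 [y2 [up' lt']]]]] : exists m1 m2 y1 y2,
      uniserial_pair l m1 m2 y1 y2 /\ (m1 + m2 < m + m')%N.
    case: d => [|d] in le_d HW nd nz *.
      exact: (uniserial_pair_improve1 S right_span up _ HW).
    apply: (uniserial_pair_improve2 S right_span left_span up _ _ HW) => // H; apply: nd => u.
    by case/(orbit_leq S (m := 1) (ltn0Sn d)) => b /(pow_rad1 S) /H [c E] ->; exists c.
  by apply: IH up'; apply: leq_trans lt' _.
move=> up; have [[i ax] [i' ax'] sx [ux ux'] [x0 x'0]] := up.
have [[c xE]|nx] := EM (exists c, x = c * x').
  apply: (H0 l x') => //; last by exists i'.
  by move=> y /sx [a [b ->]]; exists (a * c + b), 0; rewrite {1}xE mul0r addr0 mulrDl mulrA.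
have [[c xE]|nx'] := EM (exists c, x' = c * x).
  apply: (H0 l x) => //; last by exists i.
  by move=> y /sx [a [b ->]]; exists (a + b * c), 0; rewrite {1}xE mul0r addr0 mulrDl mulrA.
have [d nd Hd] := meet_orbit ux x0 nx; have [d' nd' Hd'] := meet_orbit ux' x'0 nx'.
have HW y : rl d.+1 x y <-> rl d'.+1 x' y.
  by split=> [/Hd [A B]|/Hd' [A B]]; [apply/Hd'|apply/Hd].
have [Z|nZ] := EM (forall a b u, a * x = b * x' -> J u -> u * (a * x) = 0).
  by exists i, x, i', x'.
have nz : ~ (forall u, rl d.+2 x u -> u = 0).
  move=> H; apply: nZ => a b u E Ju; apply/H/(orbitS S Ju)/Hd.
  by split; [exists a|exists b].
have [le_d|/ltnW le_d] := leqP d d'; first exact: step up ltN le_d HW nd nz.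
(* The other order of [d] and [d'] is reduced to the first by swapping the generators. *)
apply: (step d' d n' n x' x) => //; rewrite 1?addnC //.
- exact: uniserial_pairC.
- by move=> u; split=> /HW.
move=> H; apply: nz => u ru; apply: H.
by apply: (orbit_shift S (m := 1) (n := d.+1) (x := x)) => // v /HW.
Qed.

Lemma left_biserial_of_uniserial l : left_biserial_at e J l.
Proof.
have [i [x [i' [x' [[ax ax'] sx ux ux']]]]] := uniserial_span l.
have [N JN] := rad_nil S.
apply: (@uniserial_pair_biserial l N N x x'); split=> //; [by exists i|by exists i'|].
by split=> _ [b /JN -> ->]; rewrite mul0r.
Qed.

End UniserialBiserial.

(** * Opposite algebras and corners *)

Section Opposite.
Variables (k : fieldType) (V : finType) (R : pzRingType).
Variables (s : k -> R) (e : V -> R) (J : R -> Prop).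

(** The axioms are left-right symmetric apart from locality, for which [idem_local_r] is used, and
    the bracketing of the powers of [J]. *)
Lemma split_basic_op : split_basic s e J ->
  split_basic (R := R^c) s e J.
Proof.
move=> S; split.
- exact: (scal1 S).
- exact: (scalB S).
- by move=> c d; rewrite mulrC (scalM S).
- by move=> c a; rewrite -[LHS]/((a : R) * s c) -(scalC S).
- move=> i j; rewrite -[LHS]/((e j : R) * e i) (idem_mul S) eq_sym.
  by case: eqP => [->|].
- exact: (idem_sum S).
- exact: (rad0 S).
- exact: (radD S).
- by move=> a b Jb; apply: (radMr S (R := R)).
- by move=> a b Ja; apply: (radMl S (R := R)).
- have [n Jn] := rad_nil S; exists n => a H; apply: Jn.
  elim: H => {a}[a|m|m a b _ Ha _ Hb|m a b Ja _ Jb].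
  + exact: ideal_power_all.
  + exact: ideal_power_zero.
  + exact: ideal_power_add.
  + by rewrite -addn1; apply: (pow_mul S (R := R)) => //; apply: pow1.
- by move=> a i; have [c Jc] := idem_local_r S a i; exists c; rewrite (scalC S) in Jc.
Qed.

End Opposite.

Lemma right_span_of_op (k : fieldType) (V : finType) (R : pzRingType)
    (s : k -> R) (e : V -> R) (J : R -> Prop) :
  (forall l, exists i x i' x', [/\ radical_arrow (R := R^c) e J i l x /\
       radical_arrow (R := R^c) e J i' l x', radical_span (R := R^c) e J l x x',
     left_uniserial (R := R^c) x & left_uniserial (R := R^c) x']) ->
  forall i : V, right_span_at e J i.
Proof.
move=> H i; have [j [x [j' [x' [[[Jx _ ex] [Jx' _ ex']] sx ux ux']]]]] := H i.
by exists x, x'.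
Qed.

Definition good_span (V : finType) (R : pzRingType) (e : V -> R) (J : R -> Prop) :=
  forall l, exists i x i' x',
    [/\ radical_arrow e J i l x /\ radical_arrow e J i' l x',
     radical_span e J l x x', left_good e J x & left_good e J x'].

(** The intersection argument for left modules needs uniserial generators on both sides; the right
    ones come from [R^c]. *)
Lemma left_biserial_of_good (k : fieldType) (V : finType) (R : pzRingType)
    (s : k -> R) (e : V -> R) (J : R -> Prop) : split_basic s e J ->
  good_span e J -> good_span (R := R^c) e J ->
  forall l, left_biserial_at e J l.
Proof.
move=> S H H'; apply: (left_biserial_of_uniserial S).
  apply: (right_span_of_op s).
  exact: (good_span_uniserial (split_basic_op S) H').
exact: (good_span_uniserial S H).
Qed.

(* [nu] identifies [B] with the corner [f R f], [f = nu 1]. *)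
Record corner_system (k : fieldType) (V : finType) (R B : pzRingType)
    (s : k -> R) (e : V -> R) (J : R -> Prop)
    (A : {set V}) (sB : k -> B) (eB : V -> B) (nu : B -> R) : Prop := CornerSystem {
  cornerB : {morph nu : x y / x - y};
  cornerM : {morph nu : x y / x * y};
  corner_inj : injective nu;
  corner1 : nu 1 = \sum_(i in A) e i;
  corner_surj : forall a, exists b, nu b = nu 1 * a * nu 1;
  corner_scal : forall c, nu (sB c) = s c * nu 1;
  corner_idem : forall i, nu (eB i) = if i \in A then e i else 0
}.

Section CornerSystem.
Variables (k : fieldType) (V : finType) (R B : pzRingType).
Variables (s : k -> R) (e : V -> R) (J : R -> Prop).
Variables (A : {set V}) (sB : k -> B) (eB : V -> B) (nu : B -> R).
Hypothesis S : split_basic s e J.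
Hypothesis C : corner_system s e J A sB eB nu.

Notation JB := (fun b => J (nu b)).
Notation arr := (radical_arrow e J).
Notation arrB := (radical_arrow eB JB).
Notation span := (radical_span e J).

Lemma corner0 : nu 0 = 0.
Proof. by have := cornerB C 0 0; rewrite !subrr. Qed.
Lemma cornerN x : nu (- x) = - nu x.
Proof. by have := cornerB C 0 x; rewrite !sub0r corner0 sub0r. Qed.
Lemma cornerD x y : nu (x + y) = nu x + nu y.
Proof. by rewrite -[y]opprK (cornerB C) cornerN !opprK. Qed.
Lemma corner_sum (I : finType) (F : I -> B) : nu (\sum_i F i) = \sum_i nu (F i).
Proof. by apply: (big_morph nu) => [x y|]; [apply: cornerD|apply: corner0]. Qed.

Lemma corner1l b : nu 1 * nu b = nu b. Proof. by rewrite -(cornerM C) mul1r. Qed.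
Lemma corner1r b : nu b * nu 1 = nu b. Proof. by rewrite -(cornerM C) mulr1. Qed.

Lemma corner1_idem i : i \in A -> nu 1 * e i = e i.
Proof.
move=> iA; rewrite (corner1 C) mulr_suml (bigD1 i) //= (idem_id S) big1 ?addr0 // => j.
by case/andP=> _ ji; rewrite (idem_neq S).
Qed.
Lemma idem_corner1 i : i \in A -> e i * nu 1 = e i.
Proof.
move=> iA; rewrite (corner1 C) mulr_sumr (bigD1 i) //= (idem_id S) big1 ?addr0 // => j.
by case/andP=> _ ji; rewrite (idem_neq S) // eq_sym.
Qed.

Lemma corner_pow n b : ideal_power JB n b -> ideal_power J n (nu b).
Proof.
elim=> {n b}[a|m|m a b _ Ha _ Hb|m a b Ja _ Jb].
- exact: ideal_power_all.
- by rewrite corner0; apply: ideal_power_zero.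
- by rewrite cornerD; apply: ideal_power_add.
- by rewrite (cornerM C); apply: ideal_power_mul.
Qed.

(** The radical is the preimage of [J]; it is nilpotent because [nu] carries its powers into powers
    of [J]. *)
Lemma corner_split_basic : split_basic sB eB JB.
Proof.
have inj := corner_inj C.
split.
- by apply: inj; rewrite (corner_scal C) (scal1 S) mul1r.
- by move=> c d; apply: inj; rewrite (cornerB C) !(corner_scal C) (scalB S) mulrBl.
- move=> c d; apply: inj; rewrite (cornerM C) !(corner_scal C) (scalM S) -!mulrA.
  by rewrite [nu 1 * (s d * _)]mulrA -(scalC S) -[s d * _ * _]mulrA corner1l.
- move=> c a; apply: inj; rewrite !(cornerM C) (corner_scal C) -mulrA corner1l.
  by rewrite [RHS]mulrA -(scalC S) -[RHS]mulrA corner1r.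
- move=> i j; apply: inj; rewrite (cornerM C) !(corner_idem C).
  have [<-|ij] := eqVneq i j.
    by rewrite (corner_idem C); case: ifP => _; rewrite ?mul0r // (idem_id S).
  by rewrite corner0; case: ifP; case: ifP => _ _; rewrite ?mul0r ?mulr0 // (idem_neq S).
- apply: inj; rewrite corner_sum (corner1 C) [RHS]big_mkcond.
  by apply: eq_bigr => i _; rewrite (corner_idem C).
- by rewrite corner0; apply: (rad0 S).
- by move=> a b Ja Jb; rewrite cornerD; apply: (radD S).
- by move=> a b Jb; rewrite (cornerM C); apply: (radMl S).
- by move=> a b Ja; rewrite (cornerM C); apply: (radMr S).
- have [n Jn] := rad_nil S; exists n => a /corner_pow /Jn a0; apply: inj.
  by rewrite a0 corner0.
- move=> a i; have [c Jc] := idem_local S (nu a) i; exists c.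
  rewrite (cornerB C) !(cornerM C) (corner_idem C) (corner_scal C).
  case: ifP => iA; last by rewrite !mulr0 subrr; apply: (rad0 S).
  by rewrite -mulrA corner1_idem.
Qed.

Lemma corner_op : corner_system (R := R^c) (B := B^c) s e J A sB eB nu.
Proof.
split.
- exact: (cornerB C).
- by move=> x y; rewrite -[LHS]/(nu ((y : B) * x)) (cornerM C).
- exact: (corner_inj C).
- exact: (corner1 C).
- move=> a; have [b Eb] := corner_surj C a; exists b.
  rewrite Eb; exact: esym (mulrA (nu 1) a (nu 1)).
- by move=> c; rewrite (corner_scal C) (scalC S).
- exact: (corner_idem C).
Qed.

(* If no homogeneous element generates [U], each one is a [J]-multiple of another,
   hence lies in every power of [J]. *)
Lemma cyclic_of_chain (j0 : V) (U : R -> Prop) : U 0 -> (forall a u, U u -> U (a * u)) ->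
  (forall u v, U u -> U v -> exists c, u = c * v \/ v = c * u) ->
  exists j x, [/\ e j * x = x, U x & forall u, U u -> exists c, u = c * x].
Proof.
move=> U0 UM Uc; apply: contrapT => nex; have [N JN] := rad_nil S.
have next i x : e i * x = x -> U x ->
    exists j y b, [/\ e j * y = y, U y, J b, x = b * y & ~ exists c, y = c * x].
  move=> ix Ux; apply: contrapT => nex'; apply: nex; exists i, x; split=> // u Uu.
  rewrite (split_left S u).
  elim/big_ind: _ => [|a b [c ->] [c' ->]|j _]; first by exists 0; rewrite mul0r.
    by exists (c + c'); rewrite mulrDl.
  have [c [//|E]] := Uc (e j * u) x (UM _ _ Uu) Ux; first by exists c.
  have [|g [b [Jb]]] := lactE S c (i := j) (x := e j * u); first by rewrite mulrA (idem_id S).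
  rewrite -E; have [->|g0] := eqVneq g 0.
    rewrite (scal0 S) mul0r add0r => Eb.
    apply: contrapT => nc; apply: nex'; exists j, (e j * u), b; split=> //.
    + by rewrite mulrA (idem_id S).
    + exact: UM.
  rewrite -mulrDl => Eg; have [d [d1 _]] := scal_add_inv S g0 Jb.
  by exists d; rewrite Eg [d * _]mulrA d1 mul1r.
have K n i x : e i * x = x -> U x -> exists2 b, ideal_power J n b & exists y, x = b * y.
  elim: n i x => [|n IH] i x ix Ux.
    by exists 1; [apply: ideal_power_all|exists x; rewrite mul1r].
  have [j [y [b [jy Uy Jb -> _]]]] := next i x ix Ux.
  have [c Jc [z ->]] := IH j y jy Uy.
  exists (b * c); first exact: ideal_power_mul.
  by exists z; rewrite mulrA.
(* Starting from 0 gives a nonzero homogeneous [y] in [U], which factors through [J^N = 0]. *)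
have [|j [y [b [jy Uy _ _ ny]]]] := next j0 0 _ U0; first by rewrite mulr0.
have [c /JN -> [z yz]] := K N j y jy Uy.
by apply: ny; exists 0; rewrite yz !mul0r.
Qed.

Lemma corner_elt a : nu 1 * a = a -> a * nu 1 = a -> exists b, nu b = a.
Proof. by move=> a1 a2; have [b] := corner_surj C a; rewrite a1 a2; exists b. Qed.

End CornerSystem.

(** Applying the corner idempotent to [R x] gives a uniserial module over the corner. Since [x] need
    not lie in the corner, [cyclic_of_chain] supplies a new generator. *)
Lemma corner_left_biserial (k : fieldType) (V : finType) (R B : pzRingType)
    (s : k -> R) (e : V -> R) (J : R -> Prop)
    (A : {set V}) (sB : k -> B) (eB : V -> B) (nu : B -> R) :
  split_basic s e J -> corner_system s e J A sB eB nu ->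
  (forall l, left_biserial_at e J l) ->
  forall l, left_biserial_at eB (fun b => J (nu b)) l.
Proof.
move=> S C H l; have SB := corner_split_basic S C.
have nu0 := corner0 C.
have [lA|lA] := boolP (l \in A); last first.
  have el0 : eB l = 0 by apply: (corner_inj C); rewrite (corner_idem C) (negPf lA) nu0.
  have u0 : left_uniserial (0 : B) by move=> a b; exists 0; left; rewrite !mulr0.
  have a0 : radical_arrow eB (fun b => J (nu b)) l l 0.
    by split; [exact: (rad0 SB)|rewrite mulr0|rewrite mul0r].
  exists l, 0, l, 0; split=> //.
    by move=> y _; exists 0, 0; rewrite el0 !mulr0 addr0.
  by move=> a b u _ _; rewrite !mulr0.
have [i [x [i' [x' [[ax ax'] sx ux ux' Hxx']]]]] := H l.
(* With [f = nu 1], [U] is [f R z] read in [B]; comparisons in [R z] become comparisons in [U] after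
   multiplication by [f]. *)
have gen i0 z : radical_arrow e J i0 l z -> left_uniserial z -> exists j y,
    [/\ radical_arrow eB (fun b => J (nu b)) j l y, left_uniserial y,
        exists a, nu y = a * z & forall b a, nu b = a * z -> exists c, b = c * y].
  move=> [Jz ez ze] uz; pose U b := exists a, nu b = a * z.
  have [||b b' [a Ea] [a' Ea']|j [y [jy [a Ea] Hy]]] := cyclic_of_chain SB l (U := U).
  - by exists 0; rewrite mul0r.
  - by move=> b b' [a Ea]; exists (nu b * a); rewrite (cornerM C) Ea mulrA.
  - have [c Ec] := uz a a'; have [c' Ec'] := corner_surj C c; exists c'.
    have E u v : nu u = c * nu v -> u = c' * v.
      move=> Euv; apply: (corner_inj C); rewrite (cornerM C) Ec' -mulrA (corner1l C).
      by rewrite -mulrA -Euv (corner1l C).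
    by rewrite -Ea -Ea' in Ec; case: Ec => /E; [left|right].
  exists j, y; split; first split.
  - by rewrite Ea; apply: (radMl S).
  - exact: jy.
  - by apply: (corner_inj C); rewrite (cornerM C) (corner_idem C) lA Ea -mulrA ze.
  - move=> b b'.
    have UU b0 : U (b0 * y) by exists (nu b0 * a); rewrite (cornerM C) Ea mulrA.
    have [c Ec] := uz (nu b * a) (nu b' * a); have [c' Ec'] := corner_surj C c; exists c'.
    have E u v : nu u * a * z = c * (nu v * a * z) -> u * y = c' * (v * y).
      rewrite -!mulrA -Ea => Euv; apply: (corner_inj C); rewrite !(cornerM C) Ec' -!mulrA.
      by rewrite [nu 1 * (nu v * _)]mulrA (corner1l C) -Euv mulrA (corner1l C).
    by case: Ec => /E; [left|right].
  - by exists a.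
  - by move=> b a' Eb; apply: Hy; exists a'.
have [j [y [ay uy [a Ea] Hy]]] := gen i x ax ux.
have [j' [y' [ay' uy' [a' Ea'] Hy']]] := gen i' x' ax' ux'.
exists j, y, j', y'; split=> //.
  move=> b Jb; have [c [d E]] := sx _ Jb.
  have el1 : e l * nu 1 = e l by apply: (idem_corner1 S C).
  have cx u i0 z : radical_arrow e J i0 l z -> exists b0, nu b0 = nu 1 * u * z.
    move=> [_ _ ze]; have [b0 Eb0] := corner_surj C (u * z); exists b0.
    by rewrite Eb0 -!mulrA -{1}ze -mulrA el1 ze.
  have [b1 E1] := cx c i x ax; have [b2 E2] := cx d i' x' ax'.
  have [c1 F1] := Hy _ _ E1; have [c2 F2] := Hy' _ _ E2.
  exists c1, c2; rewrite -F1 -F2; apply: (corner_inj C).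
  rewrite (cornerM C) (corner_idem C) lA (cornerD C) E1 E2 -!mulrA -mulrDr -E.
  by rewrite mulrA (corner1l C).
move=> b b' u E Ju; apply: (corner_inj C); rewrite nu0 !(cornerM C) Ea mulrA.
rewrite -mulrA; rewrite [nu b * (a * x)]mulrA; apply: (Hxx' _ (nu b' * a')) => //.
by rewrite -!mulrA -Ea -Ea' -!(cornerM C) E.
Qed.

(** * Stars *)

Section Star.
Variables (k : fieldType) (V : finType) (R : pzRingType).
Variables (s : k -> R) (e : V -> R) (J : R -> Prop).
Hypothesis S : split_basic s e J.

Notation Jp := (ideal_power J).
Notation arr := (radical_arrow e J).
Notation span := (radical_span e J).

Lemma arr0 l : arr l l 0.
Proof. by split; [exact: (rad0 S)|rewrite mulr0|rewrite mul0r]. Qed.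

Lemma pow2_mul a b : J a -> J b -> Jp 2 (a * b).
Proof. by move=> Ja Jb; apply: ideal_power_mul => //; apply: pow1. Qed.

Section Plane.
Variables u v : R.

(** Coordinates modulo [J^2] with respect to [u] and [v], which need not be independent. *)
Definition coords x a b := Jp 2 (x - (s a * u + s b * v)).

Lemma coordsB c x a b x' a' b' : coords x a b -> coords x' a' b' ->
  coords (x - s c * x') (a - c * a') (b - c * b').
Proof.
rewrite /coords => H H'; have := powB S H (powMl S (s c) H'); congr (Jp 2 _).
rewrite !(scalB S) !(scalM S) !mulrBl mulrBr mulrDr !mulrA.
rewrite [in RHS](addrACA (s a * u)) -opprD !opprB.
rewrite [RHS]addrAC -!addrA; congr (_ + _).
by rewrite [LHS]addrCA [X in _ + X]addrCA.
Qed.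

Lemma coords00 x : coords x 0 0 -> Jp 2 x.
Proof. by rewrite /coords (scal0 S) !mul0r addr0 subr0. Qed.

(** Three vectors in a plane are dependent. If the first two have nonzero determinant, Cramer's rule
    expresses the third; otherwise they are proportional. *)
Lemma coords_dependent x1 a1 b1 x2 a2 b2 x3 a3 b3 :
  coords x1 a1 b1 -> coords x2 a2 b2 -> coords x3 a3 b3 ->
  [\/ Jp 2 x1, exists c, Jp 2 (x2 - s c * x1) |
      exists c d, Jp 2 (x3 - s c * x1 - s d * x2)].
Proof.
move=> H1 H2 H3; have [D0|D0] := eqVneq (a1 * b2 - a2 * b1) 0; last first.
  constructor 3; exists ((a3 * b2 - a2 * b3) / (a1 * b2 - a2 * b1)),
    ((a1 * b3 - a3 * b1) / (a1 * b2 - a2 * b1)).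
  apply: coords00.
  set c := (_ / _); set d := (_ / _).
  have := coordsB d (coordsB c H3 H1) H2; congr (coords _ _ _); by rewrite /c /d; field.
have [a0|a0] := eqVneq a1 0; last first.
  constructor 2; exists (a2 / a1); apply: coords00.
  have := coordsB (a2 / a1) H2 H1; congr (coords _ _ _); first by field.
  by rewrite -[RHS](mul0r a1^-1) -D0; field.
have [b0|b0] := eqVneq b1 0; last first.
  constructor 2; exists (b2 / b1); apply: coords00.
  have := coordsB (b2 / b1) H2 H1; congr (coords _ _ _); last by field.
  by rewrite -[RHS](mul0r (- b1^-1)) -D0; field.
by constructor 1; apply: coords00; rewrite a0 b0 in H1.
Qed.

End Plane.

(** Nakayama: generating modulo [J^2] is enough. *)
Lemma span_of_coords l u v : u * e l = u -> v * e l = v ->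
  (forall y, J y -> exists a b, coords u v (y * e l) a b) -> span l u v.
Proof.
move=> ul vl H y Jy.
apply: (nakayama S (X := fun z => exists a b, z = a * u + b * v) (m := e l)) Jy.
- by exists 0, 0; rewrite !mul0r addr0.
- by move=> _ _ [a [b ->]] [a' [b' ->]]; exists (a + a'), (b + b'); rewrite !mulrDl addrACA.
- by move=> c _ [a [b ->]]; exists (c * a), (c * b); rewrite mulrDr !mulrA.
move=> z /H [a [b Hab]]; exists (z * e l - (s a * u + s b * v)) => //.
exists (s a), (s b); rewrite mulrBl mulrDl -!mulrA (idem_id S) ul vl.
by rewrite opprB addrC subrK.
Qed.

(** Bounds the dimension of [J e_l / J^2 e_l] by two, tested on homogeneous elements; the cases
    record which element depends on the earlier ones. *)
Definition no_three_arrows l := forall i1 i2 i3 x1 x2 x3,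
  arr i1 l x1 -> arr i2 l x2 -> arr i3 l x3 ->
  [\/ Jp 2 x1, exists c, Jp 2 (x2 - s c * x1) |
      exists c d, Jp 2 (x3 - s c * x1 - s d * x2)].

(** Extracts a generating pair from a family [G] spanning [J e_l] modulo [J^2], padding with zeros.
    Spanning is expressed through the closed predicates [X] that contain [J^2] and [G]. *)
Lemma select_span l (G : R -> Prop) : no_three_arrows l ->
  G 0 -> (forall g, G g -> exists i, arr i l g) ->
  (forall X : R -> Prop, (forall x y, X x -> X y -> X (x + y)) ->
     (forall c x, X x -> X (s c * x)) -> (forall b, Jp 2 b -> X b) ->
     (forall g, G g -> X g) -> forall y, J y -> X (y * e l)) ->
  exists g g', [/\ G g, G g', span l g g', g = 0 \/ ~ Jp 2 g & g' = 0 \/ ~ Jp 2 g'].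
Proof.
move=> H3 G0 Garr HG.
have el g : G g -> g * e l = g by move=> /Garr [i []].
pose X g g' y := exists a b, coords g g' y a b.
have XG g g' : (forall h, G h -> X g g' h) -> forall y, J y -> X g g' (y * e l).
  apply: HG.
  - move=> x y [a [b Hx]] [a' [b' Hy]]; exists (a + a'), (b + b').
    rewrite /coords !(scalD S) !mulrDl addrACA opprD addrACA.
    exact: ideal_power_add.
  - move=> c x [a [b Hx]]; exists (c * a), (c * b).
    by rewrite /coords !(scalM S) -!mulrA -mulrDr -mulrBr; apply: (powMl S).
  - by move=> b Jb; exists 0, 0; rewrite /coords (scal0 S) !mul0r addr0 subr0.
have [H|/existsNP [g1 /not_implyP [G1 n1]]] := EM (forall g, G g -> Jp 2 g).
  exists 0, 0; split=> //; try by left.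
  apply: span_of_coords; rewrite ?mul0r //; apply: XG => h /H Jh.
  by exists 0, 0; rewrite /coords (scal0 S) !mul0r addr0 subr0.
have [i1 a1] := Garr _ G1.
have [H|/existsNP [g2 /not_implyP [G2 n2]]] := EM (forall g, G g -> exists c, Jp 2 (g - s c * g1)).
  exists g1, 0; split=> //; try (by left); try by right.
  apply: span_of_coords; rewrite ?mul0r ?el //; apply: XG => h /H [c Jh].
  by exists c, 0; rewrite /coords mulr0 addr0.
have [i2 a2] := Garr _ G2.
exists g1, g2; split=> //; try by right.
  apply: span_of_coords; rewrite ?el //; apply: XG => h /Garr [i3 a3].
  have [//|//|[c [d H]]] := H3 _ _ _ _ _ _ a1 a2 a3.
  by exists c, d; rewrite /coords opprD addrA.
by right=> J2; apply: n2; exists 0; rewrite (scal0 S) mul0r subr0.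
Qed.

(** A ring-theoretic substitute for an arrow from [i] to [j]. *)
Definition adjacent i j := exists2 x, J x & ~ Jp 2 (e i * x * e j).
(** Equality is allowed so that three indices also describe a star with fewer neighbours. *)
Definition near_vertex i j := [\/ j = i, adjacent i j | adjacent j i].

(** The right-hand version is obtained by applying the section to [R^c]. *)
Hypothesis star : forall i0 i1 i2 i3,
  near_vertex i0 i1 -> near_vertex i0 i2 -> near_vertex i0 i3 ->
  exists (B : pzRingType) (sB : k -> B) (eB : V -> B) (nu : B -> R),
    corner_system s e J [set i0; i1; i2; i3]%SET sB eB nu /\
    forall l, left_biserial_at eB (fun b => J (nu b)) l.

Definition corner_uniserial (A : {set V}) u := forall a b : R,
  a * (\sum_(i in A) e i) = a -> (\sum_(i in A) e i) * a = a ->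
  b * (\sum_(i in A) e i) = b -> (\sum_(i in A) e i) * b = b ->
  exists c, a * u = c * (b * u) \/ b * u = c * (a * u).

(** Reads the biserial generators of a star corner at [l] back in [R], where they generate the
    radical elements from the star to [l]. *)
Lemma star_span i0 i1 i2 i3 l :
  near_vertex i0 i1 -> near_vertex i0 i2 -> near_vertex i0 i3 ->
  l \in [set i0; i1; i2; i3]%SET ->
  exists j u j' v, [/\ arr j l u, arr j' l v,
    corner_uniserial [set i0; i1; i2; i3]%SET u,
    corner_uniserial [set i0; i1; i2; i3]%SET v &
    forall i y, i \in [set i0; i1; i2; i3]%SET -> arr i l y ->
      exists a b, y = a * u + b * v].
Proof.
move=> n1 n2 n3 lA; have [B [sB [eB [nu [C HB]]]]] := star n1 n2 n3.
move: lA C; set A := [set i0; i1; i2; i3]%SET => lA C.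
have [j [u [j' [v [[au av] suv uu uv _]]]]] := HB l.
have arrE h w : radical_arrow eB (fun b => J (nu b)) h l w -> exists h', arr h' l (nu w).
  move=> [Jw hw wl]; have wl' : nu w * e l = nu w.
    by rewrite -[in RHS]wl (cornerM C) (corner_idem C) lA.
  have := congr1 nu hw; rewrite (cornerM C) (corner_idem C); case: ifP => hA E.
    by exists h; split.
  by exists l; rewrite -E mul0r; apply: arr0.
have [h au'] := arrE _ _ au; have [h' av'] := arrE _ _ av.
have lift a : a * (\sum_(i in A) e i) = a -> (\sum_(i in A) e i) * a = a ->
    exists b, nu b = a.
  by rewrite -(corner1 C) => E E'; apply: corner_elt C _ E' E.
have uni w : left_uniserial w -> corner_uniserial A (nu w).
  move=> uw a b a1 a2 b1 b2; have [a' <-] := lift a a1 a2; have [b' <-] := lift b b1 b2.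
  have [c [E|E]] := uw a' b'; exists (nu c); [left|right].
    by rewrite -(cornerM C) E !(cornerM C).
  by rewrite -(cornerM C) E !(cornerM C).
exists h, (nu u), h', (nu v); split=> //; try exact: uni.
move=> i y iA [Jy iy yl].
have n1e : nu 1 * e i = e i by apply: (corner1_idem S C).
have el1 : e l * nu 1 = e l by apply: (idem_corner1 S C).
have [b Eb] := corner_surj C y.
have Ey : nu b = y by rewrite Eb -iy mulrA n1e iy -yl -mulrA el1.
have [|c [d E]] := suv b; first by rewrite Ey.
exists (nu c), (nu d); rewrite -!(cornerM C) -(cornerD C) -E (cornerM C).
by rewrite (corner_idem C) lA Ey yl.
Qed.

Lemma arr_near i l x : arr i l x -> x = 0 \/ ~ Jp 2 x -> exists j,
  near_vertex l j /\ arr j l x.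
Proof.
move=> ax [x0|nx]; first by exists l; split; [constructor 1|rewrite x0; apply: arr0].
exists i; split=> //; constructor 3; have [Jx ix xl] := ax.
by exists x; rewrite // ix xl.
Qed.

Lemma mem_star (i0 i1 i2 i3 : V) : [/\ i0 \in [set i0; i1; i2; i3]%SET,
  i1 \in [set i0; i1; i2; i3]%SET, i2 \in [set i0; i1; i2; i3]%SET &
  i3 \in [set i0; i1; i2; i3]%SET].
Proof. by split; rewrite !inE eqxx ?orbT. Qed.

Lemma arr_coords l i x j u j' v a b : arr i l x -> arr j l u -> arr j' l v ->
  x = a * u + b * v -> exists c d, coords u v x c d.
Proof.
move=> [Jx _ _] [Ju ju _] [Jv jv _] ->.
have [c [y [Jy ->]]] := lactE S a ju; have [d [z [Jz ->]]] := lactE S b jv.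
exists c, d; rewrite /coords addrACA [X in Jp 2 X]addrC addKr.
by apply: ideal_power_add; apply: pow2_mul.
Qed.

Lemma arr_in_corner (A : {set V}) i j y : i \in A -> j \in A -> arr i j y ->
  y * (\sum_(h in A) e h) = y /\ (\sum_(h in A) e h) * y = y.
Proof.
move=> iA jA [_ iy yj]; split.
  rewrite -yj -mulrA; congr (_ * _); rewrite mulr_sumr (bigD1 j) //= (idem_id S).
  by rewrite big1 ?addr0 // => h /andP[_ hj]; rewrite (idem_neq S) // eq_sym.
rewrite -iy mulrA; congr (_ * _); rewrite mulr_suml (bigD1 i) //= (idem_id S).
by rewrite big1 ?addr0 // => h /andP[_ hi]; rewrite (idem_neq S).
Qed.

(** Three elements outside [J^2] start at vertices near [l], so they all lie in one star corner and
    have coordinates with respect to its two generators. *)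
Lemma star_no_three l : no_three_arrows l.
Proof.
move=> i1 i2 i3 x1 x2 x3 a1 a2 a3.
have [J1|n1] := EM (Jp 2 x1); first by constructor 1.
have [J2|n2] := EM (Jp 2 x2).
  by constructor 2; exists 0; rewrite (scal0 S) mul0r subr0.
have [J3|n3] := EM (Jp 2 x3).
  by constructor 3; exists 0, 0; rewrite (scal0 S) !mul0r !subr0.
have nv i x : arr i l x -> ~ Jp 2 x -> near_vertex l i.
  by move=> [Jx ix xl] nx; constructor 3; exists x; rewrite // ix xl.
have [m0 m1 m2 m3] := mem_star l i1 i2 i3.
have [j [u [j' [v [au av _ _ H]]]]] :=
  star_span (nv _ _ a1 n1) (nv _ _ a2 n2) (nv _ _ a3 n3) m0.
have [c1 [d1 E1]] := H _ _ m1 a1; have [c2 [d2 E2]] := H _ _ m2 a2.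
have [c3 [d3 E3]] := H _ _ m3 a3.
have [f1 [g1 F1]] := arr_coords a1 au av E1; have [f2 [g2 F2]] := arr_coords a2 au av E2.
have [f3 [g3 F3]] := arr_coords a3 au av E3; exact: coords_dependent F1 F2 F3.
Qed.

Lemma star_arrows l : exists i x i' x', [/\ arr i l x, arr i' l x', span l x x',
  near_vertex l i & near_vertex l i'].
Proof.
have [|g [i ag]|X XD XC X2 XG y Jy|x [x' [[i ax] [i' ax'] sx nx nx']]] :=
    select_span (@star_no_three l) (G := fun g => exists i, arr i l g).
- by exists l; apply: arr0.
- by exists i.
- rewrite (split_left S (y * e l)); apply: (big_ind X) => //.
    exact/X2/ideal_power_zero.
  move=> i _; apply: XG; exists i; split.
  + by apply: (radMl S); apply: (radMr S).
  + by rewrite mulrA (idem_id S).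
  + by rewrite -!mulrA (idem_id S).
have [j [nj aj]] := arr_near ax nx; have [j' [nj' aj']] := arr_near ax' nx'.
by exists j, x, j', x'.
Qed.

(** It suffices that good elements span [J e_l] modulo [J^2]. An element from [j] to [l] is studied
    in the star around [j] that also contains the sources of the generators of [J e_j]. *)
Lemma star_good_span : good_span e J.
Proof.
move=> l.
have [|g [i []] |X XD XC X2 XG y Jy|x [x' [[i [ax gx]] [i' [ax' gx']] sx _ _]]] :=
    select_span (@star_no_three l) (G := fun g => exists i, arr i l g /\ left_good e J g).
- exists l; split; first exact: arr0.
  by exists l, 0; split=> [||u Ju]; [exact: (rad0 S)|rewrite mulr0|exists 0; rewrite !mulr0].
- by exists i.
- rewrite (split_left S (y * e l)); apply: (big_ind X) => //.
    exact/X2/ideal_power_zero.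
  move=> j _; rewrite mulrA; have [|nj] := EM (Jp 2 (e j * y * e l)); first exact: X2.
  have [i1 [y1 [i2 [y2 [ay1 ay2 sy n1 n2]]]]] := star_arrows j.
  have nl : near_vertex j l by constructor 2; exists y.
  have [m0 m1 m2 m3] := mem_star j l i1 i2.
  have [h [u [h' [v [au av uu uv H]]]]] := star_span nl n1 n2 m1.
  have [|a [b E]] := H j (e j * y * e l) m0.
    split; first by apply: (radMr S); apply: (radMl S).
      by rewrite !mulrA (idem_id S).
    by rewrite -!mulrA (idem_id S).
  (* If [w] does not start at [j], its contribution is in [J^2]; otherwise it is a scalar multiple
     of [w] modulo [J^2], and [w] is shown to be good. *)
  have Xw w h0 c : arr h0 l w -> corner_uniserial [set j; l; i1; i2]%SET w -> X (e j * (c * w)).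
    move=> aw uw; have [Jw hw wl] := aw; have [hj|hj] := eqVneq h0 j; last first.
      rewrite -hw !mulrA; apply/X2/pow2_mul => //; apply: (idem_local_neq S).
      by rewrite eq_sym.
    rewrite {h0}hj in aw hw; rewrite mulrA.
    have [d [z [Jz ->]]] := lactE S (e j * c) hw.
    apply: XD; last exact/X2/pow2_mul.
    apply/XC/XG; exists j; split=> //.
    have [c1 c1'] := arr_in_corner m2 m0 ay1; have [c2 c2'] := arr_in_corner m3 m0 ay2.
    (* With [y'] and [y''] generating [J e_j] and [y'' w] a multiple of [y' w], the module [J w] is
       generated by [y' w]. *)
    have step y' y'' i' : arr i' j y' -> (exists f, y'' * w = f * (y' * w)) ->
        (forall u, J u -> exists a b, u * e j = a * y' + b * y'') -> left_good e J w.
      move=> [Jy' iy' _] [f Ef] sy'; exists i', y'; split=> // t /sy' [f1 [f2 Et]].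
      exists (f1 + f2 * f); rewrite -{1}hw mulrA Et !mulrDl -!mulrA Ef.
      by rewrite mulrA.
    have [f [Ef|Ef]] := uw y1 y2 c1 c1' c2 c2'; last first.
      exact: (step y1 y2 i1 ay1 (ex_intro _ f Ef) sy).
    apply: (step y2 y1 i2 ay2 (ex_intro _ f Ef)).
    by move=> t /sy [f1 [f2 ->]]; exists f2, f1; rewrite addrC.
  have -> : e j * y * e l = e j * (e j * y * e l) by rewrite !mulrA (idem_id S).
  by rewrite E mulrDr; apply: XD; [apply: Xw au uu|apply: Xw av uv].
by exists i, x, i', x'.
Qed.

End Star.

(** * Indecomposable projective modules *)

Local Open Scope classical_set_scope.

Section Generator.
Variables (k : fieldType) (V : finType) (R : pzRingType).
Variables (s : k -> R) (e : V -> R) (J : R -> Prop).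
Hypothesis S : split_basic s e J.
Variables (M : lmodType R) (i : V) (p : M).

Notation Jp := (ideal_power J).
Notation arr := (radical_arrow e J).
Notation span := (radical_span e J).

(* [M] is isomorphic to [R e_i] through [a e_i |-> a p]. *)
Definition idem_generator :=
  [/\ e i *: p = p, forall m, exists a, m = a *: p & forall a, a *: p = 0 -> a * e i = 0].

Hypothesis gen : idem_generator.

Lemma submodule0 (U : set M) : submodule U -> U 0. Proof. by case. Qed.
Lemma submoduleZ (U : set M) a u : submodule U -> U u -> U (a *: u).
Proof. by case=> U0 Us Uu; rewrite -[_ *: _]addr0; apply: Us. Qed.
Lemma submoduleD (U : set M) u v : submodule U -> U u -> U v -> U (u + v).
Proof. by case=> U0 Us Uu Uv; rewrite -[u]scale1r; apply: Us. Qed.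

Lemma gen_inj a b : a *: p = b *: p -> a * e i = b * e i.
Proof.
move=> E; have [_ _ H] := gen; apply/eqP; rewrite -subr_eq0 -mulrBl; apply/eqP/H.
by rewrite scalerBl E subrr.
Qed.

Lemma gen_idem a : (a * e i) *: p = a *: p.
Proof. by have [ep _ _] := gen; rewrite -scalerA ep. Qed.

Lemma submodule_cyclic (m : M) : submodule [set u : M | exists a, u = a *: m].
Proof.
split=> [|a _ _ [b ->] [c ->]]; first by exists 0; rewrite scale0r.
by exists (a * b + c); rewrite scalerDl scalerA.
Qed.

Definition rad_submodule : set M := [set m | exists2 a, J a & m = a *: p].

Lemma submodule_rad : submodule rad_submodule.
Proof.
split=> [|a _ _ [b Jb ->] [c Jc ->]]; first by exists 0; [apply: (rad0 S)|rewrite scale0r].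
exists (a * b + c); last by rewrite scalerDl scalerA.
by apply: (radD S) => //; apply: (radMl S).
Qed.

Lemma submodule_gen (U : set M) : submodule U -> U p -> U = setT.
Proof.
move=> Us Up; apply/seteqP; split=> // m _; have [_ Hp _] := gen.
by have [a ->] := Hp m; apply: submoduleZ.
Qed.

(** An element outside [J p] has a nonzero scalar part, so a submodule containing it contains [p].
    Thus [M] is local. *)
Lemma proper_sub_rad (U : set M) : submodule U -> ~ U p -> U `<=` rad_submodule.
Proof.
move=> Us nUp m Um; have [ep Hp _] := gen; have [a Ea] := Hp m.
have [c [j [Jj E]]] := lactE S a (idem_id S i).
have Em : m = s c *: p + j *: p by rewrite Ea -gen_idem E scalerDl -!scalerA ep.
have [c0|c0] := eqVneq c 0.
  by exists j => //; rewrite Em c0 (scal0 S) scale0r add0r.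
have [d [d1 _]] := scal_add_inv S c0 Jj; case: nUp.
by rewrite -[p]scale1r -d1 -scalerA scalerDl -Em; apply: submoduleZ.
Qed.

Hypothesis ei0 : e i <> 0.

Lemma gen_notin_rad : ~ rad_submodule p.
Proof.
case=> a Ja E; apply: ei0; apply: (rad_fixed S Ja).
by rewrite -(gen_inj (a := 1)) ?mul1r ?scale1r.
Qed.

Lemma radicalE : radical (M := M) = rad_submodule.
Proof.
have nT (U : set M) : U <> setT -> submodule U -> ~ U p.
  by move=> UT Us Up; apply: UT; apply: submodule_gen.
have mrad : maximal_submodule rad_submodule.
  split; first exact: submodule_rad.
    by move=> E; apply: gen_notin_rad; rewrite E.
  move=> U Us sub; have [->|/(nT U) H] := EM (U = setT); first by right.
  by left; apply/seteqP; split=> //; apply: proper_sub_rad => //; apply: H.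
apply/seteqP; split=> [m /(_ _ mrad) //|m rm U [Us UT Umax]].
have UM := proper_sub_rad Us (nT U UT Us).
have [<- //|E] := Umax _ submodule_rad UM.
by case: gen_notin_rad; rewrite E.
Qed.

Lemma indecomposable_gen : indecomposable M.
Proof.
split=> [E|U W Us Ws UW UW0].
  have p0 : p = 0 by rewrite -[_ = _]/([set 0] p) -E.
  by apply: ei0; have [_ _ H] := gen; rewrite -[LHS]mul1r H // scale1r.
have [Up|nUp] := EM (U p).
  right; apply/seteqP; split=> [w Ww|_ ->]; last exact: submodule0.
  by rewrite -UW0; split=> //; rewrite (submodule_gen Us Up).
have [Wp|nWp] := EM (W p).
  left; apply/seteqP; split=> [w Ww|_ ->]; last exact: submodule0.
  by rewrite -UW0; split=> //; rewrite (submodule_gen Ws Wp).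
case: gen_notin_rad; have [u Uu [w Ww ->]] : addsm U W p by rewrite UW.
by apply: (submoduleD submodule_rad);
  [apply: (proper_sub_rad Us nUp)|apply: (proper_sub_rad Ws nWp)].
Qed.

(** Send [p] to [e_i x0] for a preimage [x0] of [f p]; this is well defined since [a p] determines
    [a e_i]. *)
Lemma projective_gen : projective M.
Proof.
move=> X Y g f surj; have [x0 Ex0] := surj (f p); have [ep Hp _] := gen.
pose c m := sval (cid (Hp m)); have cP m : m = c m *: p by apply: svalP (cid (Hp m)).
pose h m := c m *: (e i *: x0).
have hE a : h (a *: p) = a *: (e i *: x0).
  by rewrite /h !scalerA (gen_inj (b := a)) // -cP.
have hlin : linear h.
  by move=> a u v; rewrite {1}(cP u) {1}(cP v) scalerA -scalerDl hE scalerDl -scalerA.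
pose h' : {linear M -> X} := HB.pack h (GRing.isLinear.Build R M X *:%R h hlin).
exists h' => m; rewrite -[h' m]/(h m) (cP m) hE !linearZ /= Ex0.
by rewrite -linearZ /= ep.
Qed.

(** Submodules of the radical correspond to left ideals inside [J e_i]; the uniserial ones are
    cyclic, and an intersection killed by [J] is zero or simple. *)
Lemma biserial_module_gen : biserial_module M <-> left_biserial_at e J i.
Proof.
have [ep Hp _] := gen.
split.
  case=> U [W [[Us Uu] [Ws Wu] rUW UW]]; rewrite radicalE in rUW.
  have gen1 (Z : set M) : uniserial_submodule Z -> Z `<=` rad_submodule ->
      exists j x, [/\ arr j i x, Z (x *: p), left_uniserial x &
        forall a, Z (a *: p) -> exists c, a * e i = c * x].
    move=> [Zs Zu] Zrad; pose U0 a := a * e i = a /\ Z (a *: p).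
    have UM a u : U0 u -> U0 (a * u).
      by move=> [ui Zup]; split; [rewrite -mulrA ui|rewrite -scalerA; apply: submoduleZ].
    have Uc u v : U0 u -> U0 v -> exists c, u = c * v \/ v = c * u.
      move=> [ui Zup] [vi Zv].
      have sub a : Z (a *: p) -> [set m : M | exists b, m = b *: (a *: p)] `<=` Z.
        by move=> Za _ [b ->]; apply: submoduleZ.
      have [H|H] := Zu _ _ (submodule_cyclic _) (submodule_cyclic _) (sub _ Zup) (sub _ Zv).
        have [|c E] := H (u *: p); first by exists 1; rewrite scale1r.
        by exists c; left; rewrite -ui -vi mulrA; apply: gen_inj; rewrite E scalerA.
      have [|c E] := H (v *: p); first by exists 1; rewrite scale1r.
      by exists c; right; rewrite -ui -vi mulrA; apply: gen_inj; rewrite E scalerA.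
    have U00 : U0 0 by split; [rewrite mul0r|rewrite scale0r; apply: submodule0].
    have [j [x [jx Ux Hx]]] := cyclic_of_chain S i U00 UM Uc.
    have [xi Zx] := Ux; exists j, x; split=> //.
    - split=> //; have [a Ja E] := Zrad _ Zx.
      by rewrite -xi (gen_inj E); apply: (radMr S).
    - by move=> a b; apply: Uc; apply: UM.
    - move=> a Za; apply: Hx; split; first by rewrite -mulrA (idem_id S).
      by rewrite gen_idem.
  have [||j [x [ax Ux ux Hx]]] := gen1 U; first by split.
    move=> u Uu0; rewrite rUW; exists u => //; exists 0; first exact: submodule0.
    by rewrite addr0.
  have [||j' [x' [ax' Wx ux' Hx']]] := gen1 W; first by split.
    move=> u Uu0; rewrite rUW; exists 0; first exact: submodule0.
    by exists u => //; rewrite add0r.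
  exists j, x, j', x'; split=> //.
    move=> y Jy; have : rad_submodule (y *: p) by exists y.
    rewrite rUW => -[u Uu0 [w Ww0 E]].
    have [a Ea] := Hp u; have [b Eb] := Hp w.
    have [|c Ec] := Hx a; first by rewrite -Ea.
    have [|d Ed] := Hx' b; first by rewrite -Eb.
    by exists c, d; rewrite -Ec -Ed -mulrDl; apply: gen_inj; rewrite E scalerDl -Ea -Eb.
  move=> a b u E Ju; have [Jx jx xi] := ax; have [Jx' _ x'i] := ax'.
  have UWa : (U `&` W) ((a * x) *: p).
    split; first by rewrite -scalerA; apply: submoduleZ.
    by rewrite E -scalerA; apply: submoduleZ.
  have zero c : (c * x) *: p = 0 -> c * x = 0.
    by move=> H; rewrite -xi mulrA; have [_ _ Hz] := gen; apply: Hz.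
  case: UW => [UW0|[_ _ Hs]].
    by rewrite UW0 in UWa; rewrite (zero _ UWa) mulr0.
  have sub : [set m : M | exists b, m = b *: ((u * (a * x)) *: p)] `<=` U `&` W.
    move=> _ [c ->]; rewrite scalerA mulrA -scalerA; case: UWa => A B.
    by split; apply: submoduleZ.
  have [H|H] := Hs _ (submodule_cyclic _) sub.
    have : [set 0] ((u * (a * x)) *: p) by rewrite -H; exists 1; rewrite scale1r.
    by move=> /= ux0; rewrite mulrA; apply: zero; rewrite -mulrA.
  (* If [u a x p] generated the simple intersection, [a x] would equal [c u a x] with [c u] in [J],
     hence be zero. *)
  rewrite -H in UWa; case: UWa => c; rewrite scalerA mulrA => E'.
  suff -> : a * x = 0 by rewrite mulr0.
  apply: (rad_fixed S (radMl S c Ju)); have := gen_inj E'.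
  by rewrite -!mulrA xi.
case=> j [x [j' [x' [[[Jx jx xi] [Jx' jx' x'i]] sx ux ux' Hxx']]]].
have [_ _ gen0] := gen.
have cyc z : left_uniserial z -> uniserial_submodule [set m : M | exists a, m = a *: (z *: p)].
  move=> uz; split=> [|W1 W2 s1 s2 sub1 sub2]; first exact: submodule_cyclic.
  have [|/existsNP [w1 /not_implyP [W1w n2]]] := EM (W1 `<=` W2); first by left.
  right=> w2 W2w; have [a Ea] := sub1 _ W1w; have [b Eb] := sub2 _ W2w.
  have [c [E|E]] := uz a b.
    by case: n2; rewrite Ea scalerA E -!scalerA -Eb; apply: submoduleZ.
  by rewrite Eb scalerA E -!scalerA -Ea; apply: submoduleZ.
exists [set m : M | exists a, m = a *: (x *: p)], [set m : M | exists a, m = a *: (x' *: p)].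
split; [exact: cyc|exact: cyc| |].
  rewrite radicalE; apply/seteqP; split=> [_ [y Jy ->]|_ [_ [a ->] [_ [b ->] ->]]].
    have [a [b E]] := sx y Jy; exists (a *: (x *: p)); first by exists a.
    exists (b *: (x' *: p)); first by exists b.
    by rewrite -gen_idem E scalerDl !scalerA.
  exists (a * x + b * x'); last by rewrite scalerDl !scalerA.
  by apply: (radD S); apply: (radMl S).
set I := _ `&` _.
have Is : submodule I.
  have [s1 s2] := (submodule_cyclic (x *: p), submodule_cyclic (x' *: p)).
  split; first by split; apply: submodule0.
  by move=> a u v [u1 u2] [v1 v2]; split; apply: submoduleD => //; apply: submoduleZ.
have IJ u m : J u -> I m -> u *: m = 0.
  move=> Ju [[a Ea] [b Eb]]; rewrite Ea !scalerA -mulrA (Hxx' _ b) ?scale0r //.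
  by rewrite -[in LHS]xi -[in RHS]x'i !mulrA; apply: gen_inj; rewrite -!scalerA -Ea -Eb.
have [I0|nI0] := EM (I = [set 0]); [by left|right; split=> // W Ws WI].
have [W0|nW0] := EM (W = [set 0]); [by left|right; apply/seteqP; split=> // u Iu].
have [w [Ww w0]] : exists w, W w /\ w <> 0.
  apply: contrapT => nex; apply: nW0; apply/seteqP; split=> [w Ww|_ ->]; last exact: submodule0.
  by apply: contrapT => w0; apply: nex; exists w.
(* Compare [w] and [e_h u] in the chain of [R x]. A factor taking [e_h u] to [w] acts by a nonzero
   scalar, because [J] kills the intersection, and can be inverted. *)
have Wj h : W (e h *: u).
  have [[a Ea] _] := WI _ Ww; have [[b Eb] _] := Iu.
  have [c [E|E]] := ux a (e h * b).
    have Ew : w = c *: (e h *: u) by rewrite Ea Eb !scalerA E !mulrA.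
    have [g Jg] := idem_local S c h; have {}Ew : w = s g *: (e h *: u).
      rewrite Ew !scalerA -[c * e h](subrK (s g * e h)) scalerDl IJ ?add0r //.
    have g0 : g != 0 by apply/eqP => g0; apply: w0; rewrite Ew g0 (scal0 S) scale0r.
    have -> : e h *: u = s g^-1 *: w.
      by rewrite Ew scalerA -(scalM S) mulVf // (scal1 S) scale1r.
    exact: submoduleZ.
  have -> : e h *: u = c *: w by rewrite Ea Eb !scalerA E !mulrA.
  exact: submoduleZ.
rewrite -[u]scale1r -(idem_sum S) scaler_suml; apply: (big_ind W) => //.
  exact: submodule0.
by move=> y z; apply: submoduleD.
Qed.
End Generator.

(** * The left ideal generated by an idempotent, as a module *)

Section FixedLeftIdeal.
Variables (R : pzRingType) (f : R).

(** For an idempotent [f] this is [R f]. *)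
Definition fixed_pred : {pred R} := fun x => x * f == x.

Lemma fixed_pred_zmod_closed : zmod_closed fixed_pred.
Proof.
by split=> [|x y /eqP xf /eqP yf]; rewrite -topredE /= /fixed_pred ?mul0r // mulrBl xf yf.
Qed.

HB.instance Definition _ :=
  GRing.isZmodClosed.Build R fixed_pred fixed_pred_zmod_closed.

Record fixed_ideal := FixedIdeal { fixed_val :> R; fixed_valP : fixed_val \in fixed_pred }.

HB.instance Definition _ := [isSub for fixed_val].
HB.instance Definition _ := [Choice of fixed_ideal by <:].
HB.instance Definition _ := [SubChoice_isSubZmodule of fixed_ideal by <:].

Lemma fixed_scale_subproof (a : R) (x : fixed_ideal) : a * fixed_val x \in fixed_pred.
Proof. by case: x => x /= /eqP xf; rewrite -topredE /= /fixed_pred -mulrA xf. Qed.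

Definition fixed_scale a x := FixedIdeal (fixed_scale_subproof a x).

Lemma fixed_scaleA a b x : fixed_scale a (fixed_scale b x) = fixed_scale (a * b) x.
Proof. by apply/val_inj; rewrite /= mulrA. Qed.
Lemma fixed_scale1 : left_id 1 fixed_scale.
Proof. by move=> x; apply/val_inj; rewrite /= mul1r. Qed.
Lemma fixed_scaleDr : right_distributive fixed_scale +%R.
Proof. by move=> a x y; apply/val_inj; rewrite /= mulrDr. Qed.
Lemma fixed_scaleDl x : {morph fixed_scale^~ x : a b / a + b}.
Proof. by move=> a b; apply/val_inj; rewrite /= mulrDl. Qed.

HB.instance Definition _ := GRing.Zmodule_isLmodule.Build R fixed_ideal
  fixed_scaleA fixed_scale1 fixed_scaleDr fixed_scaleDl.

End FixedLeftIdeal.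

(** * Free modules and dual bases of projective modules *)

Section FreeModule.
Variables (R : pzRingType) (K : choiceType).

Definition free_module : Type := {malg R[K]}.
HB.instance Definition _ := GRing.Zmodule.on free_module.

Definition free_scale (c : R) (g : free_module) : free_module :=
  \sum_(q <- msupp g) << c * g@_q *g q >>.

Lemma free_scaleE c (g : free_module) q : (free_scale c g)@_q = c * g@_q.
Proof.
rewrite {2}[g]monalgE !raddf_sum mulr_sumr.
by apply/eq_bigr=> /= i _; rewrite !mcoeffU mulrnAr.
Qed.

Lemma free_scaleA a b g : free_scale a (free_scale b g) = free_scale (a * b) g.
Proof. by apply/malgP=> q; rewrite !free_scaleE mulrA. Qed.
Lemma free_scale1 : left_id 1 free_scale.
Proof. by move=> g; apply/malgP=> q; rewrite free_scaleE mul1r. Qed.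
Lemma free_scaleDr : right_distributive free_scale +%R.
Proof. by move=> a g h; apply/malgP=> q; rewrite !(mcoeffD, free_scaleE) mulrDr. Qed.
Lemma free_scaleDl g : {morph free_scale^~ g : a b / a + b}.
Proof. by move=> a b; apply/malgP=> q; rewrite !(mcoeffD, free_scaleE) mulrDl. Qed.

HB.instance Definition _ := GRing.Zmodule_isLmodule.Build R free_module
  free_scaleA free_scale1 free_scaleDr free_scaleDl.

End FreeModule.

Section DualBasis.
Variables (R : pzRingType) (M : lmodType R).

Definition free_eval (g : free_module R M) : M := \sum_(q <- msupp g) g@_q *: q.

Lemma free_evalE (g : free_module R M) (d : {fset M}) : (msupp g `<=` d)%fset ->
  free_eval g = \sum_(q <- d) g@_q *: q.
Proof.
move=> le_d; rewrite /free_eval (big_fset_incl _ le_d) // => q _ /mcoeff_outdom ->.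
by rewrite scale0r.
Qed.

Lemma free_eval_linear : linear free_eval.
Proof.
move=> c g h; pose d := (msupp g `|` msupp h `|` msupp (c *: g + h)%R)%fset.
rewrite !(@free_evalE _ d) /d; first last.
- exact: fsubsetUr.
- by rewrite -fsetUA fsubsetUl.
- by rewrite (fsubset_trans (fsubsetUr (msupp g) _)) ?fsubsetUl.
rewrite scaler_sumr -big_split; apply: eq_bigr => q _ /=.
by rewrite mcoeffD free_scaleE scalerDl scalerA.
Qed.

(** Lift the identity through the evaluation map from the free module on the elements of [M]; the
    coordinates of the lift are the functionals. *)
Lemma projective_dual_basis : projective M -> exists phi : M -> M -> R,
  (forall q a v w, phi q (a *: v + w) = a * phi q v + phi q w) /\
  forall v, exists r : seq M, v = \sum_(q <- r) phi q v *: q.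
Proof.
pose ev : {linear free_module R M -> M} :=
  HB.pack free_eval (GRing.isLinear.Build R (free_module R M) M *:%R free_eval free_eval_linear).
pose idM : {linear M -> M} := idfun.
move=> /(_ (free_module R M) M ev idM)[|h Eh].
  move=> m; exists << 1 *g m >>; rewrite -[LHS]/(free_eval _).
  by rewrite (free_evalE (d := [fset m]%fset)) ?msuppU_le // big_seq_fset1 mcoeffUU scale1r.
exists (fun q v => (h v)@_q); split=> [q a v w|v]; last by exists (msupp (h v)); rewrite -[LHS]Eh.
by rewrite linearP mcoeffD free_scaleE.
Qed.

End DualBasis.

(** * Classification of the indecomposable projective modules *)

Section ProjectiveIndecomposable.
Variables (k : fieldType) (V : finType) (R : pzRingType).
Variables (s : k -> R) (e : V -> R) (J : R -> Prop).
Hypothesis S : split_basic s e J.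

(** Some functional takes a value outside [J]; it splits off a copy of [R e_i], which by
    indecomposability is all of [M]. *)
Lemma projective_indecomposable_gen (M : lmodType R) : indecomposable M -> projective M ->
  exists i p, idem_generator e i (p : M) /\ e i <> 0.
Proof.
move=> [M0 ind] /projective_dual_basis [phi [phiP basis]].
have phi0 q : phi q 0 = 0.
  by have := phiP q (-1) 0 0; rewrite scaler0 addr0 mulN1r addrC subrr.
have phi_sum q (r : seq M) (c : M -> R) :
    phi q (\sum_(t <- r) c t *: t) = \sum_(t <- r) c t * phi q t.
  by elim: r => [|t r IH]; rewrite ?big_nil // !big_cons phiP IH.
(* If all coordinates were in [J], substituting the expansion of [v] into itself would put them in
   every power of [J]. *)
have [q [v nJ]] : exists q v, ~ J (phi q v).
  apply: contrapT => nex; have allJ q v : J (phi q v).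
    by apply: contrapT => nJ; apply: nex; exists q, v.
  have allP n q v : ideal_power J n (phi q v).
    elim: n v => [|n IH] v; first exact: ideal_power_all.
    have [r Er] := basis v; rewrite {1}Er phi_sum; apply: (big_ind (ideal_power J n.+1)).
    - exact: ideal_power_zero.
    - by move=> a b; apply: ideal_power_add.
    - by move=> t _; apply: ideal_power_mul.
  have [N JN] := rad_nil S; apply: M0; apply/seteqP; split=> // v _ /=.
  have [r ->] := basis v; apply: big1 => t _.
  by rewrite (JN _ (allP N t v)) scale0r.
have [i nJi] : exists i, ~ J (phi q v * e i).
  apply: contrapT => nex; apply: nJ; rewrite (split_right S (phi q v)).
  by apply: (rad_sum S) => i _; apply: contrapT => nJ; apply: nex; exists i.
have ei0 : e i <> 0 by move=> E; apply: nJi; rewrite E mulr0; apply: (rad0 S).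
have [c [j [Jj E]]] := lactE S (phi q v) (idem_id S i).
have c0 : c != 0.
  apply/eqP => c0; apply: nJi; rewrite E c0 (scal0 S) mul0r add0r.
  exact: (radMr S).
have [d [d1 _]] := scal_add_inv S c0 Jj.
have phiZ a w : phi q (a *: w) = a * phi q w by rewrite -[_ *: w]addr0 phiP phi0 addr0.
(* Rescaling [v] by [d] normalises the value at [p] to [e_i]. *)
have [p [ep pp]] : exists p, e i *: p = p /\ phi q p * e i = e i.
  exists (e i *: (d *: v)); split; first by rewrite scalerA (idem_id S).
  by rewrite !phiZ -!mulrA E -mulrDl [d * _]mulrA d1 mul1r (idem_id S).
pose U := [set m : M | exists a, m = a *: p].
(* [W] is the kernel of the projection sending [m] to [phi q m e_i p], a complement of [U = R p]. *)
pose W := [set m : M | phi q m * e i = 0].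
have Us : submodule U := submodule_cyclic p.
have Ws : submodule W.
  split; first by rewrite /W /= phi0 mul0r.
  by rewrite /W /= => a u w Hu Hw; rewrite phiP mulrDl -mulrA Hu Hw mulr0 addr0.
have UW : addsm U W = setT.
  apply/seteqP; split=> // m _; exists ((phi q m * e i) *: p); first by exists (phi q m * e i).
  exists (m - (phi q m * e i) *: p); last by rewrite addrC subrK.
  have -> : m - (phi q m * e i) *: p = (- (phi q m * e i)) *: p + m.
    by rewrite scaleNr addrC.
  by rewrite /W /= phiP mulrDl !mulNr -!mulrA pp (idem_id S) addNr.
have UW0 : U `&` W = [set 0].
  apply/seteqP; split=> [_ [[a ->] /=]|_ ->]; last by split; apply: submodule0.
  by rewrite /W /= phiZ -mulrA pp => ae; rewrite -ep scalerA ae scale0r.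
exists i, p; split=> //; have [U0|W0] := ind U W Us Ws UW UW0.
  have p0 : p = 0 by rewrite -[_ = _]/([set 0] p) -U0; exists 1; rewrite scale1r.
  by case: ei0; rewrite -pp p0 phi0 mul0r.
split=> // [m|a ap0]; last by rewrite -pp mulrA -phiZ ap0 phi0 mul0r.
have : addsm U W m by rewrite UW.
case=> _ [a ->] [w]; rewrite W0 => ->; rewrite addr0 => ->; by exists a.
Qed.

Lemma fixed_ideal_gen i : exists p : fixed_ideal (e i), idem_generator e i p.
Proof.
have eP : e i \in fixed_pred (e i) by rewrite -topredE /= /fixed_pred (idem_id S).
exists (FixedIdeal eP); split.
- by apply/val_inj; rewrite /= (idem_id S).
- by move=> m; exists (val m); apply/val_inj; case: m => m /= /eqP mf; rewrite mf.
- by move=> a /(congr1 val).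
Qed.

Lemma left_biserialP :
  (forall P : lmodType R, indecomposable P -> projective P -> biserial_module P) <->
  forall l, left_biserial_at e J l.
Proof.
split=> [H l|H M Mi Mp]; last first.
  have [i [p [gp ei0]]] := projective_indecomposable_gen Mi Mp.
  exact/(biserial_module_gen S gp ei0).
(* When [e_l = 0] the module [R e_l] is zero, not indecomposable, and zero generators are used
   instead. *)
have [el0|el0] := EM (e l = 0); last first.
  have [p gp] := fixed_ideal_gen l; apply/(biserial_module_gen S gp el0); apply: H.
    exact: (indecomposable_gen S gp el0).
  exact: projective_gen gp.
have u0 : left_uniserial (0 : R) by move=> a b; exists 0; left; rewrite !mulr0.
exists l, 0, l, 0; split=> //.
- by split; apply: (arr0 S).
- by move=> y _; exists 0, 0; rewrite el0 !mulr0 addr0.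
- by move=> a b u _ _; rewrite !mulr0.
Qed.

End ProjectiveIndecomposable.

Lemma biserialP (k : fieldType) (V : finType) (R : pzRingType)
    (s : k -> R) (e : V -> R) (J : R -> Prop) : split_basic s e J ->
  biserial R <-> (forall l, left_biserial_at e J l) /\
                 (forall l, left_biserial_at (R := R^c) e J l).
Proof.
move=> S; split=> [[H H']|[H H']]; split.
- exact/(left_biserialP S).
- exact/(left_biserialP (split_basic_op S)).
- exact/(left_biserialP S).
- exact/(left_biserialP (split_basic_op S)).
Qed.

(** * Quiver algebras *)

Lemma ideal_power_op (k : fieldType) (V : finType) (R : pzRingType)
    (s : k -> R) (e : V -> R) (J : R -> Prop) n a : split_basic s e J ->
  ideal_power J n a -> ideal_power (R := R^c) J n a.
Proof.
move=> S; elim=> {n a}[a|n|n a b _ Ha _ Hb|n a b Ja _ Jb].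
- exact: ideal_power_all.
- exact: ideal_power_zero.
- exact: ideal_power_add.
- rewrite -addn1; exact: (pow_mul (split_basic_op S) Jb (pow1 (R := R^c) Ja)).
Qed.

(** The opposite ring reverses arrows, and nearness ignores their direction. *)
Lemma near_vertex_op (k : fieldType) (V : finType) (R : pzRingType)
    (s : k -> R) (e : V -> R) (J : R -> Prop) i j : split_basic s e J ->
  near_vertex (R := R^c) e J i j -> near_vertex e J i j.
Proof.
move=> S; have adj i' j' : adjacent (R := R^c) e J i' j' -> adjacent e J j' i'.
  case=> x Jx nx; exists x => // H; apply: nx.
  have -> : ((e i' : R^c) * x * e j' : R^c) = (e j' * x * e i' : R).
    exact: (@mulrA R (e j') x (e i')).
  exact: ideal_power_op S H.
by case=> [->|/adj|/adj]; [constructor 1|constructor 3|constructor 2].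
Qed.

Lemma generated_ideal_sub (R : pzRingType) (X : set R) : X `<=` generated_ideal X.
Proof. by move=> x Xx I; apply. Qed.
Lemma generated_ideal0 (R : pzRingType) (X : set R) : generated_ideal X 0.
Proof. by move=> I _; apply: ideal0. Qed.
Lemma generated_idealD (R : pzRingType) (X : set R) x y :
  generated_ideal X x -> generated_ideal X y -> generated_ideal X (x + y).
Proof. by move=> Hx Hy I XI; apply: idealD; [apply: Hx|apply: Hy]. Qed.
Lemma generated_idealMl (R : pzRingType) (X : set R) a x :
  generated_ideal X x -> generated_ideal X (a * x).
Proof. by move=> Hx I XI; apply: idealMl; apply: Hx. Qed.
Lemma generated_idealMr (R : pzRingType) (X : set R) a x :
  generated_ideal X x -> generated_ideal X (x * a).
Proof. by move=> Hx I XI; apply: idealMr; apply: Hx. Qed.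

(** * Arrows span the radical modulo its square *)

Section ArrowSpan.
Variables (k : fieldType) (V : finType) (R : pzRingType).
Variables (s : k -> R) (e : V -> R) (J : R -> Prop).
Hypothesis S : split_basic s e J.
Variables (A : finType) (src tgt : A -> V) (ar : A -> R).
Hypothesis ar_arrow : forall a, radical_arrow e J (src a) (tgt a) (ar a).

Definition arrow_span x :=
  exists c : A -> k, ideal_power J 2 (x - \sum_a s (c a) * ar a).

Lemma arrow_span0 : arrow_span 0.
Proof.
exists (fun=> 0); rewrite big1 ?subr0; first exact: ideal_power_zero.
by move=> a _; rewrite (scal0 S) mul0r.
Qed.

Lemma arrow_spanD x y : arrow_span x -> arrow_span y -> arrow_span (x + y).
Proof.
move=> [c Hc] [d Hd]; exists (fun a => c a + d a).
have -> : \sum_a s (c a + d a) * ar a = \sum_a s (c a) * ar a + \sum_a s (d a) * ar a.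
  by rewrite -big_split; apply: eq_bigr => a _; rewrite (scalD S) mulrDl.
by rewrite opprD addrACA; apply: ideal_power_add.
Qed.

(** Modulo [J], [x] acts at the target of each arrow by the scalar [cs a]; the errors lie in
    [J^2]. *)
Lemma arrow_spanMr x y : arrow_span y -> arrow_span (y * x).
Proof.
move=> [c Hc]; pose cs a := sval (cid (idem_local_r S x (tgt a))).
have csP a : J (e (tgt a) * x - s (cs a) * e (tgt a)).
  exact: (svalP (cid (idem_local_r S x (tgt a)))).
exists (fun a => c a * cs a).
have -> : y * x - \sum_a s (c a * cs a) * ar a = (y - \sum_a s (c a) * ar a) * x +
    \sum_a s (c a) * (ar a * (e (tgt a) * x - s (cs a) * e (tgt a))).
  rewrite mulrBl -addrA; congr (_ + _); rewrite mulr_suml -!sumrN -big_split.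
  apply: eq_bigr => a _ /=; have [_ _ ar_r] := ar_arrow a.
  rewrite mulrBr mulrA ar_r [ar a * (s _ * _)]mulrA.
  rewrite -(scalC S) -[s (cs a) * _ * _]mulrA ar_r (scalM S) mulrBr !mulrA.
  by rewrite addKr.
apply: ideal_power_add; first exact: (powMr S).
apply: (big_ind (ideal_power J 2)) => [||a _].
- exact: ideal_power_zero.
- by move=> *; apply: ideal_power_add.
- by apply: (powMl S); apply: pow2_mul => //; case: (ar_arrow a).
Qed.

Lemma arrow_spanMl x y : arrow_span y -> arrow_span (x * y).
Proof.
move=> [c Hc]; pose cs a := sval (cid (idem_local S x (src a))).
have csP a : J (x * e (src a) - s (cs a) * e (src a)).
  exact: (svalP (cid (idem_local S x (src a)))).
exists (fun a => c a * cs a).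
have -> : x * y - \sum_a s (c a * cs a) * ar a = x * (y - \sum_a s (c a) * ar a) +
    \sum_a s (c a) * ((x * e (src a) - s (cs a) * e (src a)) * ar a).
  rewrite mulrBr -addrA; congr (_ + _); rewrite mulr_sumr -!sumrN -big_split.
  apply: eq_bigr => a _ /=; have [_ ar_l _] := ar_arrow a.
  rewrite mulrBl -!mulrA ar_l mulrBr (scalM S) [x * (s _ * _)]mulrA -[x * s _](scalC S).
  by rewrite -!mulrA addKr.
apply: ideal_power_add; first exact: (powMl S).
apply: (big_ind (ideal_power J 2)) => [||a _].
- exact: ideal_power_zero.
- by move=> *; apply: ideal_power_add.
- by apply: (powMl S); apply: pow2_mul => //; case: (ar_arrow a).
Qed.

Lemma arrow_span_arrow a : arrow_span (ar a).
Proof.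
exists (fun b => (b == a)%:R); rewrite (bigD1 a) //= eqxx (scal1 S) mul1r.
rewrite big1 ?addr0 ?subrr; first exact: ideal_power_zero.
by move=> b /negPf ->; rewrite (scal0 S) mul0r.
Qed.

(** Cutting by [e_i] and [e_j] keeps only the arrows from [i] to [j]; without any, the result lies
    in [J^2]. *)
Lemma arrow_span_corner i j x : arrow_span x -> ~ ideal_power J 2 (e i * x * e j) ->
  exists a, src a = i /\ tgt a = j.
Proof.
move=> [c Hc] nx; apply: contrapT => nex; apply: nx.
have := powMr S (e j) (powMl S (e i) Hc); rewrite mulrBr mulrBl.
rewrite [X in _ - X](_ : _ = 0) ?subr0 // mulr_sumr mulr_suml big1 // => a _.
have [_ ar_l ar_r] := ar_arrow a; rewrite [e i * _]mulrA -(scalC S) -!mulrA.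
have [jE|jE] := eqVneq (tgt a) j; last by rewrite -ar_r -mulrA (idem_neq S) // !mulr0.
have [iE|iE] := eqVneq i (src a).
  by case: nex; exists a.
by rewrite -ar_l !mulrA -[_ * e i * e _]mulrA (idem_neq S) // mulr0 !mul0r.
Qed.

End ArrowSpan.

(** * Admissible quotients of path algebras as split basic algebras *)

Section QuiverAlgebra.
Variables (k : fieldType) (Q : quiver) (I : two_sided_ideal (path_algebra k Q)).
Hypothesis hI : admissible I.

Notation KQ := (path_algebra k Q).
Notation pi := (to_quotient I).
Notation e := (vertex_idem I).

Definition quotient_scal (c : k) : quotient I := pi (c *: (1 : KQ)).
Definition quotient_rad (x : quotient I) : Prop := exists2 y, arrow_ideal y & x = pi y.

Notation s := quotient_scal.
Notation J := quotient_rad.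

Lemma path_scaleAl (c : k) (x y : KQ) : (c *: x) * y = c *: (x * y).
Proof. exact: pa_mulZl. Qed.
Lemma path_scaleAr (c : k) (x y : KQ) : x * (c *: y) = c *: (x * y).
Proof. exact: pa_mulZr. Qed.

Lemma path_elt_trivial_or_arrow (p : qpath Q) :
  p = trivial_path (qpath_source p) \/ arrow_ideal (path_elt k p).
Proof.
case: p => -[i [|a t]] wp; first by left; apply/val_inj.
right; have /andP[/eqP ai wt] : (source a == i) && walk (target a) t by exact: wp.
pose q := @QPath Q (target a, t) wt.
have -> : path_elt k (QPath wp) = path_elt k (arrow_path a) * path_elt k q.
  rewrite [RHS]pa_mulUU /path_mul; case E: (qpath_cat _ _) => [r|].
    have [_ er] := (qpath_catP _ _ _).1 E; congr path_elt; apply/val_inj.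
    by rewrite /= er /qpath_source /qpath_arrows /= ai.
  by case/qpath_cat_None: E.
by apply/generated_idealMr/generated_ideal_sub; exists a.
Qed.

Lemma arrow_idealZ (c : k) (x : KQ) : arrow_ideal x -> arrow_ideal (c *: x).
Proof.
have <- : (c *: (1 : KQ)) * x = c *: x by rewrite path_scaleAl mul1r.
exact: generated_idealMl.
Qed.

(** By linearity only a path [p] matters, and [p e_i] is zero, [e_i] itself, or in the arrow
    ideal. *)
Lemma path_local (x : KQ) i : exists c : k,
  arrow_ideal (x * path_elt k (trivial_path i) - c *: path_elt k (trivial_path i)).
Proof.
move: x; apply: path_elt_ind => [|c x y [a Ha] [b Hb]|p].
- by exists 0; rewrite mul0r scale0r subr0; apply: generated_ideal0.
- exists (c * a + b); rewrite mulrDl path_scaleAl scalerDl -scalerA opprD addrACA -scalerBr.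
  apply: generated_idealD; [exact: (arrow_idealZ c Ha)|exact: Hb].
have -> : path_elt k p * path_elt k (trivial_path i) = path_mul k p (trivial_path i).
  exact: pa_mulUU.
rewrite path_1mul; have [ip|_] := eqVneq i (qpath_target p); last first.
  by exists 0; rewrite scale0r subr0; apply: generated_ideal0.
have [E|Jp] := path_elt_trivial_or_arrow p; last by exists 0; rewrite scale0r subr0.
exists 1; rewrite scale1r; suff -> : p = trivial_path i by rewrite subrr; apply: generated_ideal0.
by rewrite ip E.
Qed.

(** Links the inductive powers of [J] to [exp_ideal], in terms of which admissibility is stated. *)
Lemma quotient_pow n x : ideal_power J n x ->
  exists2 y, exp_ideal (@arrow_ideal k Q) n y & x = pi y.
Proof.
elim=> {n x}[x|n|n x y _ [x' Jx ->] _ [y' Jy ->]|n x y [x' Jx ->] _ [y' Jy ->]].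
- by exists (quotient_lift x); rewrite ?quotient_liftK.
- by exists 0; [case: n => //= n; apply: generated_ideal0|rewrite rmorph0].
- exists (x' + y'); last by rewrite rmorphD.
  by case: n Jx Jy => //= n; apply: generated_idealD.
- exists (x' * y'); last by rewrite rmorphM.
  by apply: generated_ideal_sub; exists x' => //; exists y'.
Qed.

Lemma quotient_split_basic : split_basic s e J.
Proof.
split.
- by rewrite /s scale1r rmorph1.
- by move=> c d; rewrite /s scalerBl rmorphB.
- by move=> c d; rewrite /s -rmorphM path_scaleAl mul1r scalerA.
- move=> c a; rewrite -[a]quotient_liftK /s -!rmorphM path_scaleAl path_scaleAr.
  by rewrite mul1r mulr1.
- exact: vertex_idemM.
- by rewrite /vertex_idem -rmorph_sum -[RHS](rmorph1 pi).
- by exists 0; [apply: generated_ideal0|rewrite rmorph0].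
- move=> _ _ [a Ja ->] [b Jb ->]; exists (a + b); last by rewrite rmorphD.
  exact: generated_idealD.
- move=> a _ [b Jb ->]; exists (quotient_lift a * b); last by rewrite rmorphM /= quotient_liftK.
  exact: generated_idealMl.
- move=> _ b [a Ja ->]; exists (a * quotient_lift b); last by rewrite rmorphM /= quotient_liftK.
  exact: generated_idealMr.
- have [m _ [mI _]] := hI; exists m => a /quotient_pow [y /mI Iy ->].
  by rewrite -[RHS](rmorph0 pi); apply/eq_to_quotient; rewrite subr0.
- move=> a i; have [c Hc] := path_local (quotient_lift a) i; exists c.
  rewrite -{1}[a]quotient_liftK /s /vertex_idem -!rmorphM -rmorphB.
  by eexists; [exact: Hc|rewrite path_scaleAl mul1r].
Qed.

Let S := quotient_split_basic.

Definition quotient_arrow (a : arrow Q) : quotient I := pi (path_elt k (arrow_path a)).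

Lemma quotient_arrowP a : radical_arrow e J (source a) (target a) (quotient_arrow a).
Proof.
split.
- by exists (path_elt k (arrow_path a)) => //; apply: generated_ideal_sub; exists a.
- rewrite /quotient_arrow /vertex_idem -rmorphM; congr (pi _); rewrite [LHS]pa_mulUU path_mul1.
  by rewrite /qpath_source /= eqxx.
- rewrite /quotient_arrow /vertex_idem -rmorphM; congr (pi _); rewrite [LHS]pa_mulUU path_1mul.
  by rewrite /qpath_target /= eqxx.
Qed.

(** The elements whose class is in the arrow span form a two-sided ideal containing the arrows, so
    this ideal contains [arrow_ideal]. *)
Lemma rad_arrow_span y : arrow_ideal y -> arrow_span s J quotient_arrow (pi y).
Proof.
pose Y y := arrow_span s J quotient_arrow (pi y).
have Y0 : Y 0 by rewrite /Y rmorph0; exact: (arrow_span0 S).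
have YD x z : Y x -> Y z -> Y (x + z).
  by rewrite /Y rmorphD; exact: (arrow_spanD S).
have YMl x z : Y z -> Y (x * z).
  by rewrite /Y rmorphM; exact: (arrow_spanMl S quotient_arrowP).
have YMr x z : Y z -> Y (z * x).
  by rewrite /Y rmorphM; exact: (arrow_spanMr S quotient_arrowP).
move=> /(_ (TwoSidedIdeal Y0 YD YMl YMr)); apply=> _ [a ->].
exact: (arrow_span_arrow S).
Qed.

Lemma adjacent_arrow i j : adjacent e J i j ->
  exists a : arrow Q, source a = i /\ target a = j.
Proof.
case=> _ [y Jy ->]; exact: (arrow_span_corner S quotient_arrowP (rad_arrow_span Jy)).
Qed.

Lemma near_neighbour i j : near_vertex e J i j -> j <> i -> j \in neighbours i.
Proof.
move=> n ji; rewrite inE; apply/andP; split; first exact/eqP.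
by case: n => [//|/adjacent_arrow|/adjacent_arrow] [a [sa ta]];
  apply/existsP; exists a; rewrite sa ta !eqxx ?orbT.
Qed.

Lemma star_idemE l (A : {set vertex Q}) : A \subset neighbours l ->
  star_idem I l A = \sum_(i in (l |: A)%SET) e i.
Proof.
move=> /fintype.subsetP AN; rewrite big_setU1 //.
by apply/negP => /AN; rewrite inE eqxx.
Qed.

Lemma star_corner l (A : {set vertex Q}) (hA : A \subset neighbours l) :
  exists sB eB, corner_system s e J (l |: A)%SET sB eB
    (@corner_val _ _ (star_idemP I hA)).
Proof.
set f := star_idem I l A; pose B := corner f (star_idemP I hA).
have ff : f * f = f by apply: star_idemP.
have inB a : exists b : B, corner_val b = f * a * f.
  have aP : f * a * f \in corner_pred f by apply/corner_predP; exists a.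
  by exists (Corner _ aP).
have fe i : i \in (l |: A)%SET -> f * e i * f = e i.
  move=> iA; rewrite /f star_idemE // mulr_suml (bigD1 i) //= (idem_id S) big1 ?addr0.
    rewrite mulr_sumr (bigD1 i) //= (idem_id S) big1 ?addr0 // => h /andP[_ hi].
    by rewrite (idem_neq S) // eq_sym.
  by move=> h /andP[_ hi]; rewrite (idem_neq S).
exists (fun c => sval (cid (inB (s c)))),
  (fun i => if i \in (l |: A)%SET then sval (cid (inB (e i))) else 0).
split=> //.
- by move=> [x xP] [y yP] /= E; apply/val_inj.
- exact: star_idemE.
- by move=> c; rewrite (svalP (cid (inB (s c)))) -(scalC S) -mulrA ff.
- by move=> i; case: ifP => // /fe E; rewrite (svalP (cid (inB (e i)))).
Qed.

End QuiverAlgebra.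

(** * Biseriality and the star corners of a quiver algebra *)

Theorem theorem1p2 (k : closedFieldType) (Q : quiver)
    (I : two_sided_ideal (path_algebra k Q)) (hI : admissible I) :
  biserial (quotient I) <->
  forall (l : vertex Q) (J : {set vertex Q}) (hJ : J \subset neighbours l),
    (#|J| <= 3)%N -> biserial (corner (star_idem I l J) (star_idemP I hJ)).
Proof.
have S := quotient_split_basic hI; split.
  move=> /(biserialP S) [H H'] l A hA _; have [sB [eB C]] := star_corner hI hA.
  apply/(biserialP (corner_split_basic S C)); split.
    exact: (corner_left_biserial S C H).
  exact: (corner_left_biserial (split_basic_op S) (corner_op S C) H').
move=> H; have star i0 i1 i2 i3 :
    near_vertex (vertex_idem I) (quotient_rad (I := I)) i0 i1 ->
    near_vertex (vertex_idem I) (quotient_rad (I := I)) i0 i2 ->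
    near_vertex (vertex_idem I) (quotient_rad (I := I)) i0 i3 ->
    exists (B : pzRingType) (sB : k -> B) (eB : vertex Q -> B) (nu : B -> quotient I),
      [/\ corner_system (@quotient_scal k Q I) (vertex_idem I) (@quotient_rad k Q I)
            [set i0; i1; i2; i3]%SET sB eB nu,
          forall l, left_biserial_at eB (fun b => quotient_rad (nu b)) l &
          forall l, left_biserial_at (R := B^c) eB (fun b => quotient_rad (nu b)) l].
  (* The three vertices may coincide with each other or with [i0]; removing [i0] leaves at most
     three genuine neighbours, and adding it back recovers the star. *)
  move=> n1 n2 n3; pose A := ([set i0; i1; i2; i3] :\ i0)%SET.
  have hA : A \subset neighbours i0.
    have := fun j => near_neighbour (i := i0) (j := j) hI; move: (neighbours i0) => N nearN.
    apply/fintype.subsetP => i; rewrite !inE => /andP[/eqP ii0].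
    by case/orP=> [/orP[/orP[|]|]|] /eqP E; subst i => //; apply: nearN.
  have A3 : (#|A| <= 3)%N.
    apply: (@leq_trans #|[set i1; i2; i3]%SET|).
      by apply/subset_leq_card/fintype.subsetP => i; rewrite !inE => /andP[/negPf ->] /=.
    by rewrite (leq_trans (leq_card_setU _ _)) // cards1 addn1 ltnS cards2; case: (_ == _).
  have [sB [eB C]] := star_corner hI hA.
  have EA : (i0 |: A = [set i0; i1; i2; i3])%SET by rewrite finset.setD1K // !inE eqxx.
  have /(biserialP (corner_split_basic S C)) [HB HB'] := H i0 A hA A3.
  by rewrite EA in C; exists (corner _ (star_idemP I hA)), sB, eB, (@corner_val _ _ _).
have good : good_span (vertex_idem I) (quotient_rad (I := I)).
  apply: (star_good_span S) => i0 i1 i2 i3 n1 n2 n3.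
  have [B [sB [eB [nu [C HB _]]]]] := star i0 i1 i2 i3 n1 n2 n3.
  by exists B, sB, eB, nu.
(* The same star corners serve on the right, with their opposites as corners of the opposite
   algebra. *)
have good' : good_span (R := (quotient I)^c) (vertex_idem I) (quotient_rad (I := I)).
  apply: (star_good_span (split_basic_op S)) => i0 i1 i2 i3 n1 n2 n3.
  have [B [sB [eB [nu [C _ HB]]]]] := star i0 i1 i2 i3 (near_vertex_op S n1)
    (near_vertex_op S n2) (near_vertex_op S n3).
  by exists B^c, sB, eB, nu; split=> //; apply: (corner_op S C).
apply/(biserialP S); split; first exact: (left_biserial_of_good S good good').
exact: (left_biserial_of_good (split_basic_op S) good' good).
Qed.
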